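(* The doubly distributive skew hyperfields are precisely (up to isomorphism) those skew hyperfields of the form $F\rtimes_{H,\psi}G$ (the $G$-layering of a skew hyperfield $F$ along a short exact sequence of groups $1\to F^\times\to H\xrightarrow{\psi}G\to1$ with stable sums, $G$ a totally ordered group) of exactly one of the following types: (1) $F$ is the Krasner hyperfield; (2) $F$ is the sign hyperfield; (3) $F$ is a skew field and $G$ satisfies $\{ab\mid a,b\in G,\ a,b<1_G\}=\{c\in G\mid c<1_G\}$.
   Context: A hyperoperation on a set $S$ is a map $\boxplus$ from $S\times S$ to the nonempty subsets of $S$; for nonempty $A,B\subseteq S$ put $A\boxplus B=\bigcup_{a\in A,b\in B}a\boxplus b$; $\boxplus$ is associative if $a\boxplus(b\boxplus c)=(a\boxplus b)\boxplus c$ for all $a,b,c$. A hypergroup is $(G,\boxplus,0)$ with $\boxplus$ an associative hyperoperation such that: $0\boxplus x=x\boxplus 0=\{x\}$ for all $x$; for every $x$ there is a unique $x'$ with $0\in x\boxplus x'$ and a unique $x''$ with $0\in x''\boxplus x$, and $x'=x''$, denoted $-x$; and $x\in y\boxplus z$ if and only if $-x\in -z\boxplus -y$. It is commutative if $y\boxplus z=z\boxplus y$ for all $y,z$. A skew hyperring is $(R,\odot,\boxplus,1,0)$ with $(R,\odot,1)$ a monoid, $(R,\boxplus,0)$ a commutative hypergroup, $x\odot 0=0\odot x=0$, and $a\odot(x\boxplus y)=(a\odot x)\boxplus(a\odot y)$, $(x\boxplus y)\odot a=(x\odot a)\boxplus(y\odot a)$. A skew hyperfield is a skew hyperring with $0\ne1$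 in which every nonzero element has a multiplicative inverse. It is doubly distributive if $(a\boxplus b)(c\boxplus d)=ac\boxplus ad\boxplus bc\boxplus bd$ for all $a,b,c,d$ (products of sets being taken elementwise). A skew field is regarded as a skew hyperfield with $a\boxplus b=\{a+b\}$. The Krasner hyperfield is $\mathbb{K}=\{0,1\}$ with usual multiplication, $0\boxplus x=x\boxplus 0=\{x\}$ and $1\boxplus1=\{0,1\}$. The sign hyperfield is $\mathbb{S}=\{0,1,-1\}$ with usual multiplication, $0\boxplus x=x\boxplus 0=\{x\}$, $x\boxplus x=\{x\}$, $1\boxplus-1=-1\boxplus 1=\{0,1,-1\}$. Layering: let $F$ be a skew hyperfield, $F^\times=F\setminus\{0_F\}$, $G$ a totally ordered group (order invariant under left and right multiplication, identity $1_G$), and $1\to F^{\times}\xrightarrow{\phi}H\xrightarrow{\psi}G\to1$ a short exact sequence of groups; replacing $H$ by an isomorphic copy, assume $\phi$ is the inclusion. For $h\in H$ put $x^h=h^{-1}xh$ for $x\in F^\times$ and $0_F^h=0_F$. The sequence has stable sums if for each $h\in H$ the map $x\mapsto x^h$ is an automorphism of the skew hyperfield $F$. In that case let $0$ be a new element not in $H$; for $g\in G$ let $A_g=\psi^{-1}(g)\cup\{0\}$ and, for any $h\in\psi^{-1}(g)$, let $\lambda_h:F\to A_g$ be the bijection $0_F\mapsto0$, $x\mapsto hx$. Transporting the hyperaddition of $F$ along $\lambda_h$ gives a hypergroup structure $\boxplus_g$ on $A_g$ independent of the choice of $h$. The $G$-layering $F\rtimes_{H,\psi}G$ has ground set $H\cup\{0\}$;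 multiplication is that of $H$, with $x\cdot y=0$ if $x$ or $y$ is $0$; $0$ is the additive identity and for $x,y\in H$: $x\boxplus y=\{x\}$ if $\psi(x)>\psi(y)$; $=\{y\}$ if $\psi(x)<\psi(y)$; $=x\boxplus_{\psi(x)}y$ if $\psi(x)=\psi(y)$ and $0\notin x\boxplus_{\psi(x)}y$; $=(x\boxplus_{\psi(x)}y)\cup\{z\in H\mid\psi(z)<\psi(x)\}$ if $\psi(x)=\psi(y)$ and $0\in x\boxplus_{\psi(x)}y$. *)

(* Defs.v *)
From HB Require Import structures.
From mathcomp Require Import all_boot all_order ssralg.
From mathcomp Require Import boolp classical_sets.

Set Implicit Arguments.
Unset Strict Implicit.
Unset Printing Implicit Defensive.

Import Order.TTheory GRing.Theory.

Declare Scope hyper_scope.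
Local Open Scope group_scope.
Local Open Scope classical_set_scope.
Local Open Scope hyper_scope.

Reserved Notation "x ⊞ y" (at level 50, left associativity).
Reserved Notation "A `⊞` B" (at level 50, left associativity).

Definition set_lift (S : Type) (op : S -> S -> set S) (A B : set S) : set S :=
  \bigcup_(a in A) \bigcup_(b in B) op a b.

(* As usual in MathComp, the opposite is part of the data: haddxN and haddNx
   say that -x is the unique two-sided inverse of x. *)
HB.mixin Record isHypergroup (S : Type) := {
  hzero : S;
  hopp : S -> S;
  hadd : S -> S -> set S;
  hadd_neq0 : forall x y, hadd x y !=set0;
  haddA : forall x y z,
    set_lift hadd [set x] (hadd y z) = set_lift hadd (hadd x y) [set z];
  hadd0x : forall x, hadd hzero x = [set x];
  haddx0 : forall x, hadd x hzero = [set x];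
  haddxN : forall x y, hadd x y hzero <-> y = hopp x;
  haddNx : forall x y, hadd y x hzero <-> y = hopp x;
  hadd_rev : forall x y z, hadd y z x <-> hadd (hopp z) (hopp y) (hopp x)
}.

#[short(type="hypergroupType")]
HB.structure Definition Hypergroup := {S of isHypergroup S}.

Notation "0" := (@hzero _) : hyper_scope.
Notation "- x" := (hopp x) : hyper_scope.
Notation "x ⊞ y" := (hadd x y) : hyper_scope.
Notation "A `⊞` B" := (set_lift hadd A B) : hyper_scope.

HB.mixin Record Hypergroup_isCommutative S of Hypergroup S := {
  haddC : forall x y : S, x ⊞ y = y ⊞ x
}.

#[short(type="comHypergroupType")]
HB.structure Definition ComHypergroup :=
  {S of Hypergroup S & Hypergroup_isCommutative S}.

HB.mixin Record Monoid_isSkewHyperring R of Monoid R & ComHypergroup R := {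
  hmulx0 : forall x : R, x * (0 : R) = 0;
  hmul0x : forall x : R, (0 : R) * x = 0;
  hmulDr : forall a x y : R, [set a * z | z in x ⊞ y] = (a * x) ⊞ (a * y);
  hmulDl : forall a x y : R, [set z * a | z in x ⊞ y] = (x * a) ⊞ (y * a)
}.

#[short(type="skewHyperringType")]
HB.structure Definition SkewHyperring :=
  {R of Monoid R & ComHypergroup R & Monoid_isSkewHyperring R}.

HB.mixin Record SkewHyperring_isSkewHyperfield F of SkewHyperring F := {
  hzero_neq1 : (0 : F) <> 1;
  hinvertible : forall x : F, x <> 0 -> exists y, x * y = 1 /\ y * x = 1
}.

#[short(type="skewHyperfieldType")]
HB.structure Definition SkewHyperfield :=
  {F of SkewHyperring F & SkewHyperring_isSkewHyperfield F}.

Definition hyperfield_isomorphism (R S : skewHyperfieldType) (f : R -> S) :=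
  [/\ bijective f, f 0 = 0, f 1 = 1, {morph f : x y / x * y} &
      forall x y, f @` (x ⊞ y) = f x ⊞ f y].

Definition hyperfield_isomorphic (R S : skewHyperfieldType) :=
  exists f : R -> S, hyperfield_isomorphism f.

Definition doubly_distributive (R : skewHyperfieldType) :=
  forall a b c d : R,
    [set x * y | x in a ⊞ b & y in c ⊞ d] =
    (a * c ⊞ a * d) `⊞` [set b * c] `⊞` [set b * d].

(* GRing.field_axiom does not require commutativity, so D is a skew field. *)
Definition hyperfield_of (D : unitRingType) (_ : GRing.field_axiom D) : Type :=
  D.

Section HyperfieldOf.
Variables (D : unitRingType) (fD : GRing.field_axiom D).
Local Notation HD := (hyperfield_of fD).

HB.instance Definition _ := Choice.copy HD D.
HB.instance Definition _ := isMonoid.Build HD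
  (@mulrA D) (@mul1r D) (@mulr1 D).

Let add (x y : D) : set D := [set (x + y)%R].

Let addE x y z : add x y z <-> z = (x + y)%R. Proof. by []. Qed.

Let add_neq0 x y : add x y !=set0.
Proof. by exists (x + y)%R. Qed.

Let addA x y z : set_lift add [set x] (add y z) = set_lift add (add x y) [set z].
Proof.
by rewrite /set_lift /add !bigcup_set1 addrA.
Qed.

Let add0x x : add 0%R x = [set x]. Proof. by rewrite /add add0r. Qed.
Let addx0 x : add x 0%R = [set x]. Proof. by rewrite /add addr0. Qed.

Let addxN x y : add x y 0%R <-> y = (- x)%R.
Proof.
by rewrite addE; split=> [/esym/eqP|->]; rewrite ?subrr // addrC addr_eq0 => /eqP.
Qed.

Let addNx x y : add y x 0%R <-> y = (- x)%R.
Proof. by rewrite /add addrC; exact: addxN. Qed.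

Let add_rev x y z : add y z x <-> add (- z)%R (- y)%R (- x)%R.
Proof. by rewrite !addE -opprD addrC; split=> [->//|/oppr_inj]. Qed.

HB.instance Definition _ := isHypergroup.Build HD
  add_neq0 addA add0x addx0 addxN addNx add_rev.

Let addC (x y : HD) : x ⊞ y = y ⊞ x.
Proof. by rewrite /hadd /= /add addrC. Qed.

HB.instance Definition _ := Hypergroup_isCommutative.Build HD addC.

Let mulDr (a x y : HD) : [set a * z | z in x ⊞ y] = (a * x) ⊞ (a * y).
Proof. by rewrite /hadd /= /add image_set1 -mulrDr. Qed.

Let mulDl (a x y : HD) : [set z * a | z in x ⊞ y] = (x * a) ⊞ (y * a).
Proof. by rewrite /hadd /= /add image_set1 -mulrDl. Qed.

HB.instance Definition _ := Monoid_isSkewHyperring.Build HD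
  (@mulr0 D) (@mul0r D) mulDr mulDl.

Let neq01 : (0 : HD) <> 1.
Proof. by apply/eqP; rewrite eq_sym oner_eq0. Qed.

Let invertible (x : HD) : x <> 0 -> exists y, x * y = 1 /\ y * x = 1.
Proof.
move=> /eqP/fD x_unit; exists (x : D)^-1%R.
by split; [exact: (divrr x_unit)|exact: (mulVr x_unit)].
Qed.

HB.instance Definition _ :=
  SkewHyperring_isSkewHyperfield.Build HD neq01 invertible.

End HyperfieldOf.

Lemma set_lift_table_assoc (S : eqType) (e : seq S) (op : S -> S -> set S)
    (b : S -> S -> S -> bool) :
    (forall x, x \in e) -> (forall x y z, op x y z <-> b x y z) ->
    (forall x y z w, has (fun t => b y z t && b x t w) e =
                     has (fun t => b x y t && b t z w) e) ->
  forall x y z, set_lift op [set x] (op y z) = set_lift op (op x y) [set z].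
Proof.
move=> inE opE bA x y z; rewrite eqEsubset; split=> w.
  rewrite /set_lift bigcup_set1 => -[t /opE yzt /opE xtw].
  have /hasP[u _ /andP[xyu uzw]] :
      has (fun u => b x y u && b u z w) e.
    by rewrite -bA; apply/hasP; exists t; rewrite ?yzt.
  by exists u; [exact/opE | exists z => //; exact/opE].
move=> [t /opE xyt [_ ->] /opE tzw].
have /hasP[u _ /andP[yzu xuw]] :
    has (fun u => b y z u && b x u w) e.
  by rewrite bA; apply/hasP; exists t; rewrite ?xyt.
by exists x => //; exists u; exact/opE.
Qed.

Variant krasner : predArgType := K0 | K1.

Definition bool_of_krasner (x : krasner) := if x is K0 then false else true.
Definition krasner_of_bool (b : bool) := if b then K1 else K0.

Lemma bool_of_krasnerK : cancel bool_of_krasner krasner_of_bool.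
Proof. by case. Qed.

HB.instance Definition _ :=
  Countable.copy krasner (can_type bool_of_krasnerK).

Definition krasner_mul (x y : krasner) := if x is K0 then K0 else y.

Definition krasner_add (x y : krasner) : set krasner :=
  match x, y with
  | K0, z | z, K0 => [set z]
  | K1, K1 => [set K0; K1]
  end.

Section Krasner.

Let mulA : associative krasner_mul. Proof. by case. Qed.
Let mul1x : left_id K1 krasner_mul. Proof. by []. Qed.
Let mulx1 : right_id K1 krasner_mul. Proof. by case. Qed.

HB.instance Definition _ := isMonoid.Build krasner mulA mul1x mulx1.

Let addb x y z :=
  match x, y with K0, w | w, K0 => z == w | K1, K1 => true end.

Let addE x y z : krasner_add x y z <-> addb x y z.
Proof.
case: x; case: y; case: z; split => //=; do ?by move=> /eqP.
- by move=> _; left.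
- by move=> _; right.
Qed.

Let add_neq0 x y : krasner_add x y !=set0.
Proof. by exists (if x is K0 then y else x); apply/addE; case: x; case: y. Qed.

Let addC x y : krasner_add x y = krasner_add y x.
Proof. by case: x; case: y. Qed.

Let addA x y z : set_lift krasner_add [set x] (krasner_add y z) =
  set_lift krasner_add (krasner_add x y) [set z].
Proof.
apply: (set_lift_table_assoc (e := [:: K0; K1]) _ addE); first by case.
by do 4?[case].
Qed.

Let add0x x : krasner_add K0 x = [set x]. Proof. by case: x. Qed.
Let addx0 x : krasner_add x K0 = [set x]. Proof. by case: x. Qed.

Let addxN x y : krasner_add x y K0 <-> y = x.
Proof. by rewrite addE; case: x; case: y. Qed.

Let addNx x y : krasner_add y x K0 <-> y = x.
Proof. by rewrite addC; exact: addxN. Qed.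

Let add_rev x y z : krasner_add y z x <-> krasner_add z y x.
Proof. by rewrite addC. Qed.

HB.instance Definition _ := isHypergroup.Build krasner
  add_neq0 addA add0x addx0 addxN addNx add_rev.

HB.instance Definition _ := Hypergroup_isCommutative.Build krasner addC.

Let mulC x y : krasner_mul x y = krasner_mul y x.
Proof. by case: x; case: y. Qed.
Let mulx0 x : krasner_mul x K0 = K0. Proof. by rewrite mulC. Qed.
Let mul0x x : krasner_mul K0 x = K0. Proof. by []. Qed.

Let mulDr (a x y : krasner) : [set a * z | z in x ⊞ y] = (a * x) ⊞ (a * y).
Proof.
rewrite eqEsubset; split=> [_ [z xyz <-]|z].
  move/addE: xyz => xyz; apply/addE.
  by move: xyz; case: a; case: x; case: y; case: z.
case: a => [/addE/eqP->|xyz]; last by exists z.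
by have [t xyt] := hadd_neq0 x y; exists t.
Qed.

Let mulDl (a x y : krasner) : [set z * a | z in x ⊞ y] = (x * a) ⊞ (y * a).
Proof.
rewrite /mul /= -!(mulC a); have /= <- := mulDr a x y.
by apply: eq_imagel => z _; exact: mulC.
Qed.

HB.instance Definition _ := Monoid_isSkewHyperring.Build krasner
  mulx0 mul0x mulDr mulDl.

Let neq01 : K0 <> K1. Proof. by []. Qed.

Let invertible (x : krasner) : x <> K0 ->
  exists y, krasner_mul x y = K1 /\ krasner_mul y x = K1.
Proof. by case: x => // _; exists K1. Qed.

HB.instance Definition _ :=
  SkewHyperring_isSkewHyperfield.Build krasner neq01 invertible.

End Krasner.

Variant sign : predArgType := S0 | S1 | Sm1.

Definition option_of_sign (x : sign) :=
  match x with S0 => None | S1 => Some true | Sm1 => Some false end.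
Definition sign_of_option (b : option bool) :=
  match b with None => S0 | Some true => S1 | Some false => Sm1 end.

Lemma option_of_signK : cancel option_of_sign sign_of_option.
Proof. by case. Qed.

HB.instance Definition _ := Countable.copy sign (can_type option_of_signK).

Definition sign_opp (x : sign) :=
  match x with S0 => S0 | S1 => Sm1 | Sm1 => S1 end.

Definition sign_mul (x y : sign) :=
  match x with S0 => S0 | S1 => y | Sm1 => sign_opp y end.

Definition sign_add (x y : sign) : set sign :=
  match x, y with
  | S0, z | z, S0 => [set z]
  | S1, S1 => [set S1]
  | Sm1, Sm1 => [set Sm1]
  | S1, Sm1 | Sm1, S1 => [set S0; S1; Sm1]
  end.

Section Sign.

Let mulA : associative sign_mul. Proof. by case=> [] [] []. Qed.
Let mul1x : left_id S1 sign_mul. Proof. by []. Qed.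
Let mulx1 : right_id S1 sign_mul. Proof. by case. Qed.

HB.instance Definition _ := isMonoid.Build sign mulA mul1x mulx1.

Let addb x y z :=
  match x, y with
  | S0, w | w, S0 => z == w
  | S1, S1 => z == S1
  | Sm1, Sm1 => z == Sm1
  | S1, Sm1 | Sm1, S1 => true
  end.

Let addE x y z : sign_add x y z <-> addb x y z.
Proof.
by case: x; case: y; case: z; split => //=; do ?[by move=> /eqP];
   move=> _; first [by right | by left; right | by left; left].
Qed.

Let add_neq0 x y : sign_add x y !=set0.
Proof. by exists (if x is S0 then y else x); apply/addE; case: x; case: y. Qed.

Let addC x y : sign_add x y = sign_add y x.
Proof. by case: x; case: y. Qed.

Let addA x y z : set_lift sign_add [set x] (sign_add y z) =
  set_lift sign_add (sign_add x y) [set z].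
Proof.
apply: (set_lift_table_assoc (e := [:: S0; S1; Sm1]) _ addE); first by case.
by do 4?[case].
Qed.

Let add0x x : sign_add S0 x = [set x]. Proof. by case: x. Qed.
Let addx0 x : sign_add x S0 = [set x]. Proof. by case: x. Qed.

Let addxN x y : sign_add x y S0 <-> y = sign_opp x.
Proof. by rewrite addE; case: x; case: y. Qed.

Let addNx x y : sign_add y x S0 <-> y = sign_opp x.
Proof. by rewrite addC; exact: addxN. Qed.

Let add_rev x y z :
  sign_add y z x <-> sign_add (sign_opp z) (sign_opp y) (sign_opp x).
Proof. by rewrite !addE; case: x; case: y; case: z. Qed.

HB.instance Definition _ := isHypergroup.Build sign
  add_neq0 addA add0x addx0 addxN addNx add_rev.

HB.instance Definition _ := Hypergroup_isCommutative.Build sign addC.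

Let mulC x y : sign_mul x y = sign_mul y x.
Proof. by case: x; case: y. Qed.
Let mulx0 x : sign_mul x S0 = S0. Proof. by rewrite mulC. Qed.
Let mul0x x : sign_mul S0 x = S0. Proof. by []. Qed.

Let mulDr (a x y : sign) : [set a * z | z in x ⊞ y] = (a * x) ⊞ (a * y).
Proof.
have sub b u v w : sign_add u v w ->
    sign_add (sign_mul b u) (sign_mul b v) (sign_mul b w).
  by rewrite !addE; case: b; case: u; case: v; case: w.
rewrite eqEsubset; split=> [_ [z xyz <-]|z axyz]; first exact: sub.
case a0 : (a == S0).
  have [t xyt] := hadd_neq0 x y; exists t => //.
  by move/addE: axyz; rewrite (eqP a0) => /eqP.
exists (a * z).
  by have := sub a _ _ _ axyz; rewrite !mulA; case: (a) a0.
by rewrite /mul /= mulA; case: (a) a0; case: (z).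
Qed.

Let mulDl (a x y : sign) : [set z * a | z in x ⊞ y] = (x * a) ⊞ (y * a).
Proof.
rewrite /mul /= -!(mulC a); have /= <- := mulDr a x y.
by apply: eq_imagel => z _; exact: mulC.
Qed.

HB.instance Definition _ := Monoid_isSkewHyperring.Build sign
  mulx0 mul0x mulDr mulDl.

Let neq01 : S0 <> S1. Proof. by []. Qed.

Let invertible (x : sign) : x <> S0 ->
  exists y, sign_mul x y = S1 /\ sign_mul y x = S1.
Proof. by case: x => // _; [exists S1|exists Sm1]. Qed.

HB.instance Definition _ :=
  SkewHyperring_isSkewHyperfield.Build sign neq01 invertible.

End Sign.

Section SkewHyperfieldTheory.
Variable F : skewHyperfieldType.
Implicit Types x y z w : F.

Lemma hadd_assoc x y z w t :
  (y ⊞ z) t -> (x ⊞ t) w -> exists2 s, (x ⊞ y) s & (s ⊞ z) w.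
Proof.
move=> yzt xtw; have : ([set x] `⊞` (y ⊞ z)) w by exists x => //; exists t.
by rewrite haddA => -[s xys [_ -> szw]]; exists s.
Qed.

Lemma hadd_assocr x y z w s :
  (x ⊞ y) s -> (s ⊞ z) w -> exists2 t, (y ⊞ z) t & (x ⊞ t) w.
Proof.
rewrite (haddC x y) [s ⊞ z]haddC => yxs zsw.
by have [t] := hadd_assoc yxs zsw; rewrite haddC [t ⊞ x]haddC; exists t.
Qed.

Lemma hoppK : involutive (@hopp F).
Proof. by move=> x; apply/esym/haddNx/haddxN. Qed.

Lemma hadd_sub x y z : (x ⊞ y) z -> (z ⊞ - y) x.
Proof.
move=> xyz; have [t yzt] := hadd_assocr xyz (proj2 (haddxN z _) erefl).
by move=> /haddxN tE; apply/hadd_rev; rewrite hoppK -tE.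
Qed.

Lemma hopp0 : - (0 : F) = 0.
Proof. by apply/esym/haddxN; rewrite hadd0x. Qed.

Lemma hmulxN1 x : x * - (1 : F) = - x.
Proof.
apply/haddxN; rewrite -[x in x ⊞ _]mulg1 -hmulDr.
by exists 0; [exact/haddxN | exact: hmulx0].
Qed.

Lemma hmul_neq0 x y : x != 0 -> y != 0 -> x * y != 0.
Proof.
move=> x0 /eqP/hinvertible[y' [yy' _]]; apply/eqP => xy0.
by move/eqP: x0; rewrite -[x]mulg1 -yy' mulgA xy0 hmul0x.
Qed.

Lemma hone_neq0 : (1 : F) != 0.
Proof. by apply/eqP => /esym/hzero_neq1. Qed.

Lemma hopp_eq0 x : (- x == 0) = (x == 0).
Proof. by rewrite -{2}hopp0 (inv_eq hoppK) eq_sym hopp0 eq_sym. Qed.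

Lemma hopp_neq0 x : x != 0 -> - x != 0.
Proof. by rewrite hopp_eq0. Qed.

Definition hinv x : F := xget 0 [set y | x * y = 1 /\ y * x = 1].

Lemma hinvP x : x != 0 -> x * hinv x = 1 /\ hinv x * x = 1.
Proof. by move=> /eqP/hinvertible x_inv; exact: (xgetPex 0 x_inv). Qed.

Lemma hinv_neq0 x : x != 0 -> hinv x != 0.
Proof.
move=> /hinvP[xV _]; apply/eqP => V0; move: xV.
by rewrite V0 hmulx0 => /hzero_neq1.
Qed.

End SkewHyperfieldTheory.

Definition hunit (F : skewHyperfieldType) := {x : F | x != 0}.

Section UnitGroup.
Variable F : skewHyperfieldType.

HB.instance Definition _ := SubChoice.on (hunit F).

Implicit Types u v : hunit F.

Definition hunit_one : hunit F := Sub 1 (hone_neq0 F).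
Definition hunit_mul u v : hunit F :=
  Sub (val u * val v) (hmul_neq0 (valP u) (valP v)).
Definition hunitN1 : hunit F :=
  Sub (- (1 : F)) (hopp_neq0 (hone_neq0 F)).
Definition hunit_inv u : hunit F := Sub (hinv (val u)) (hinv_neq0 (valP u)).

Let mulA : associative hunit_mul.
Proof. by move=> u v w; apply: val_inj; rewrite /= mulgA. Qed.
Let mul1u : left_id hunit_one hunit_mul.
Proof. by move=> u; apply: val_inj; rewrite /= mul1g. Qed.
Let mulu1 : right_id hunit_one hunit_mul.
Proof. by move=> u; apply: val_inj; rewrite /= mulg1. Qed.
Let mulVu : left_inverse hunit_one hunit_inv hunit_mul.
Proof. by move=> u; apply: val_inj; case: (hinvP (valP u)). Qed.
Let muluV : right_inverse hunit_one hunit_inv hunit_mul.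
Proof. by move=> u; apply: val_inj; case: (hinvP (valP u)). Qed.

HB.instance Definition _ :=
  isGroup.Build (hunit F) mulA mul1u mulu1 mulVu muluV.

End UnitGroup.

HB.mixin Record isTranslationInvariant d G of Group G & Order.POrder d G := {
  le_mulg2l : forall z x y : G, (x <= y)%O -> (z * x <= z * y)%O;
  le_mulg2r : forall z x y : G, (x <= y)%O -> (x * z <= y * z)%O
}.

#[short(type="orderedGroupType")]
HB.structure Definition OrderedGroup d :=
  {G of Group G & Order.Total d G & isTranslationInvariant d G}.

Section Extensions.
Variables (F : skewHyperfieldType) (H : groupType).
Variable phi : {multiplicative hunit F -> H}.

Definition short_exact (G : groupType) (psi : {multiplicative H -> G}) :=
  [/\ injective phi, range phi = [set h | psi h = 1] & range psi = setT].

(* The map x |-> x^h on F, read through phi; the default value u of xget is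
   irrelevant as soon as the range of phi is a normal subgroup. *)
Definition hconj (h : H) (x : F) : F :=
  if insub x is Some u then val (xget u [set v | phi v = phi u ^ h]) else 0.

Definition stable_sums := forall h, hyperfield_isomorphism (hconj h).

(* The map lambda_h : x |-> h x, with 0_F |-> None. *)
Definition layer_map (h : H) (x : F) : option H :=
  omap (fun u => h * phi u) (insub x).

End Extensions.

Record stable_extension (F : skewHyperfieldType) d (G : orderedGroupType d) :=
  StableExtension {
    ext_group : groupType;
    ext_incl : {multiplicative hunit F -> ext_group};
    ext_proj : {multiplicative ext_group -> G};
    ext_exact : short_exact ext_incl ext_proj;
    ext_stable : stable_sums ext_incl
  }.

Arguments ext_stable {F d G} _ h.

(* None is the new zero element. *)
Definition layering (F : skewHyperfieldType) d (G : orderedGroupType d)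
  (E : stable_extension F G) : Type := option (ext_group E).

Section Layering.
Variables (F : skewHyperfieldType) (d : Order.disp_t) (G : orderedGroupType d).
Variable E : stable_extension F G.

Local Notation H := (ext_group E).
Local Notation phi := (@ext_incl F d G E).
Local Notation psi := (@ext_proj F d G E).
Local Notation lam := (layer_map phi).

Implicit Types (g : G) (h k l : H) (a b c : F) (x y z w : option H).

Definition layering_mul x y : option H :=
  match x, y with Some h, Some k => Some (h * k) | _, _ => None end.

Definition layering_opp x : option H :=
  if x is Some h then Some (h * phi (hunitN1 F)) else None.

(* The hyperaddition of F transported to the tier of g; see tier_addE for its
   independence of h. *)
Definition tier_add g x y : set (option H) :=
  [set z | exists h a b c,
     [/\ psi h = g, lam h a = x, lam h b = y, (a ⊞ b) c & lam h c = z]].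

Definition layering_add x y : set (option H) :=
  match x, y with
  | None, z | z, None => [set z]
  | Some h, Some k =>
    if (psi h > psi k)%O then [set x]
    else if (psi h < psi k)%O then [set y]
    else if `[< ~ tier_add (psi h) x y None >] then tier_add (psi h) x y
    else tier_add (psi h) x y `|` [set Some l | l in [set l | psi l < psi h]%O]
  end.

Let phi_inj : injective phi. Proof. by case: (ext_exact E). Qed.

Let psi_phi u : psi (phi u) = 1.
Proof.
by case: (ext_exact E) => _ + _ => /seteqP[+ _] => /(_ (phi u)); apply; exists u.
Qed.

Let kerP h : psi h = 1 -> exists u, phi u = h.
Proof.
case: (ext_exact E) => _ + _ => /seteqP[_ +] => /(_ h) /[apply].
by case=> u _ <-; exists u.
Qed.

Let psi1 : psi 1 = 1.
Proof. by apply: (mulgI (psi 1)); rewrite -gmulfM !mulg1. Qed.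

Let psiV h : psi h^-1 = (psi h)^-1.
Proof. by apply: (mulgI (psi h)); rewrite -gmulfM !mulgV psi1. Qed.

Let phi1 : phi 1 = 1.
Proof. by apply: (mulgI (phi 1)); rewrite -gmulfM !mulg1. Qed.

Let lam0 h : lam h 0 = None.
Proof. by rewrite /layer_map insubF ?eqxx. Qed.

Let lam_val h (u : hunit F) : lam h (val u) = Some (h * phi u).
Proof. by rewrite /layer_map valK. Qed.

Let hunitP a : a = 0 \/ exists u : hunit F, a = val u.
Proof.
by have [->|a0] := eqVneq a 0; [left|right; exists (Sub a a0); rewrite SubK].
Qed.

Let lam_inj h : injective (lam h).
Proof.
move=> a b; have [->|[u ->]] := hunitP a; have [->|[v ->]] := hunitP b;
  rewrite ?lam0 ?lam_val //.
by case=> /mulgI/phi_inj->.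
Qed.

Let lam_rebase h k : psi h = psi k ->
  exists u : hunit F, forall a, lam h a = lam k (val u * a).
Proof.
move=> hk; have [|u phiu] := @kerP (k^-1 * h).
  by rewrite gmulfM psiV hk mulVg.
exists u => a; have [->|[v ->]] := hunitP a; first by rewrite hmulx0 !lam0.
have -> : val u * val v = val (u * v) by [].
by rewrite !lam_val gmulfM phiu !mulgA mulgV mul1g.
Qed.

Lemma tier_addE h x y :
  tier_add (psi h) x y =
  [set z | exists a b c, [/\ lam h a = x, lam h b = y, (a ⊞ b) c & lam h c = z]].
Proof.
rewrite eqEsubset; split=> z; last by move=> [a [b [c []]]]; exists h, a, b, c.
move=> [k [a [b [c [/lam_rebase[u uE] <- <- abc <-]]]]].
exists (val u * a), (val u * b), (val u * c); split=> //.
by rewrite -hmulDr; exists c.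
Qed.

Let lev h x := if x is Some k then (psi k <= psi h)%O else true.

(* The element of F that layer_map h sends to x if there is one, else 0: the
   leading coefficient of x when x lies at or below the tier of h. *)
Let res h x : F := xget 0 [set a | lam h a = x].

Let lamK h a : res h (lam h a) = a.
Proof. by apply: xget_unique => // b; exact: lam_inj. Qed.

Let res0 h : res h None = 0. Proof. by rewrite -(lam0 h) lamK. Qed.

Let resK h k : psi k = psi h -> lam h (res h (Some k)) = Some k.
Proof.
move=> kh; have [|u phiu] := @kerP (h^-1 * k).
  by rewrite gmulfM psiV kh mulVg.
apply: (@xgetPex _ 0 [set a | lam h a = Some k]).
by exists (val u); rewrite /= lam_val phiu mulgA mulgV mul1g.
Qed.

Let psi_lam h a k : lam h a = Some k -> psi k = psi h.
Proof.
have [->|[u ->]] := hunitP a; rewrite ?lam0 ?lam_val // => -[<-].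
by rewrite gmulfM psi_phi mulg1.
Qed.

Let res_eq0 h k : psi k != psi h -> res h (Some k) = 0.
Proof.
move=> kh; rewrite /res; case: xgetP => // a _ /psi_lam kh'.
by rewrite kh' eqxx in kh.
Qed.

Let res_neq0 h k : psi k = psi h -> res h (Some k) != 0.
Proof. by move=> /resK kE; apply/eqP => k0; move: kE; rewrite k0 lam0. Qed.

Let lev_lam h a : lev h (lam h a).
Proof. by case kE : (lam h a) => [k|] //=; rewrite (psi_lam kE). Qed.

Let lam_eq h x y : res h x = res h y -> res h x != 0 -> x = y.
Proof.
have aux z : res h z != 0 -> lam h (res h z) = z.
  case: z => [k|]; last by rewrite res0 eqxx.
  by have [/resK//|/res_eq0->] := eqVneq (psi k) (psi h); rewrite eqxx.
by move=> xy x0; rewrite -[LHS]aux // xy aux // -xy.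
Qed.

Let add0x x : layering_add None x = [set x]. Proof. by case: x. Qed.
Let addx0 x : layering_add x None = [set x]. Proof. by case: x. Qed.

Let tier_addC g x y : tier_add g x y = tier_add g y x.
Proof.
rewrite eqEsubset; split=> z [h [a [b [c [hg ax b_y abc cz]]]]];
  by exists h, b, a, c; split=> //; rewrite haddC.
Qed.

Let addC x y : layering_add x y = layering_add y x.
Proof.
case: x => [h|]; case: y => [k|] //=.
by case: ltgtP => // ->; rewrite tier_addC.
Qed.

Let top h x := exists2 k, x = Some k & psi k = psi h.

Let top_res h x : top h x <-> res h x != 0.
Proof.
split=> [[k -> /res_neq0]//|].
case: x => [k|]; last by rewrite res0 eqxx.
by have [|/res_eq0->] := eqVneq (psi k) (psi h); [exists k | rewrite eqxx].
Qed.

Let single_top h k : psi k = psi h -> forall z,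
  z = Some k <-> lev h z /\ res h z = res h (Some k).
Proof.
move=> kh z; split=> [->|[_ zk]]; first by rewrite /= kh lexx.
by apply: (lam_eq zk); rewrite zk res_neq0.
Qed.

Let addP_top h x y z : top h x -> lev h y ->
  layering_add x y z <-> lev h z /\ (res h x ⊞ res h y) (res h z).
Proof.
move=> [k -> kh]; case: y => [l|_]; last first.
  by rewrite addx0 res0 haddx0; exact: single_top.
rewrite /lev /= -kh le_eqVlt => /predU1P[lk|lk]; last first.
  have l0 : res h (Some l) = 0 by apply: res_eq0; rewrite -kh lt_eqF.
  rewrite lk l0 haddx0.
  by have := single_top kh z; rewrite /lev -kh.
rewrite lk ltxx kh tier_addE.
set T := [set z | _].
have TE w : T w <-> (w = None \/ top h w) /\
    (res h (Some k) ⊞ res h (Some l)) (res h w).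
  split=> [[a [b [c [ak bl abc <-]]]]|[w_top klw]].
    rewrite -ak -bl !lamK; split=> //.
    case cE : (lam h c) => [m|]; [right|by left].
    by exists m => //; exact: psi_lam cE.
  exists (res h (Some k)), (res h (Some l)), (res h w).
  split; rewrite ?resK ?lk //.
  by case: w_top => [->|[m -> /resK]//]; rewrite res0 lam0.
have levE w : lev h w ->
    (w = None \/ top h w) \/ (exists2 m, w = Some m & psi m < psi h)%O.
  case: w => [m|]; last by left; left.
  by rewrite /= le_eqVlt => /predU1P[mh|mh]; [left; right|right]; exists m.
have topE w : (w = None \/ top h w) -> lev h w.
  by case=> [->|[m -> mh]] //=; rewrite mh.
case: ifPn => /asboolP TN.
  rewrite TE; split=> -[wt klw]; split=> //; first exact: topE.
  case: (levE _ wt) => // -[m zE mh]; case: TN; apply/TE; split; first by left.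
  by rewrite res0; move: klw; rewrite zE (@res_eq0 h m) // lt_eqF.
move/contrapT/TE: TN => -[_]; rewrite res0 => kl0; split.
  case=> [/TE[/topE zh klz]//|[m /= mh <-]]; split; first exact: ltW.
  by rewrite (@res_eq0 h m) // lt_eqF.
case=> /levE[zt klz|[m -> mh _]]; first by left; apply/TE.
by right; exists m.
Qed.

Let addP h x y z : top h x \/ top h y -> lev h x -> lev h y ->
  layering_add x y z <-> lev h z /\ (res h x ⊞ res h y) (res h z).
Proof.
case=> [xt _ yh|yt xh _]; first exact: addP_top.
by rewrite addC haddC; exact: addP_top.
Qed.

Let ex_top x y : (x = None /\ y = None) \/
  exists h, [/\ top h x \/ top h y, lev h x & lev h y].
Proof.
case: x => [h|]; case: y => [k|]; last by left.
- right; have [kh|hk] := leP (psi k) (psi h).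
    by exists h; split; rewrite /= ?lexx //; left; exists h.
  by exists k; split; rewrite /= ?lexx ?ltW //; right; exists k.
- by right; exists h; split; rewrite /= ?lexx //; left; exists h.
- by right; exists k; split; rewrite /= ?lexx //; right; exists k.
Qed.

Let lev_add h x y z : lev h x -> lev h y -> layering_add x y z -> lev h z.
Proof.
have [[-> ->]|[k [xyt xk yk]]] := ex_top x y; first by move=> _ _ ->.
move=> xh yh /(addP _ xyt xk yk)[+ _]; case: z => //= l /le_trans; apply.
by case: xyt => -[m mE <-]; [move: xh|move: yh]; rewrite mE.
Qed.

Let add_neq0 x y : layering_add x y !=set0.
Proof.
have [[-> ->]|[h [xyt xh yh]]] := ex_top x y; first by exists None.
have [c xyc] := hadd_neq0 (res h x) (res h y).
by exists (lam h c); apply/(addP _ xyt xh yh); rewrite lamK; split.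
Qed.

Let psi_oppr k : psi (k * phi (hunitN1 F)) = psi k.
Proof. by rewrite gmulfM psi_phi mulg1. Qed.

Let loppK : involutive layering_opp.
Proof.
case=> //= h; congr Some; rewrite -mulgA -gmulfM.
have -> : hunitN1 F * hunitN1 F = 1.
  by apply: val_inj; rewrite /= hmulxN1 hoppK.
by rewrite phi1 mulg1.
Qed.

Let lev_opp h x : lev h (layering_opp x) = lev h x.
Proof. by case: x => //= k; rewrite psi_oppr. Qed.

Let res_opp h x : res h (layering_opp x) = - res h x.
Proof.
case: x => [k|] /=; last by rewrite res0 hopp0.
have [kh|kh] := eqVneq (psi k) (psi h); last first.
  by rewrite !res_eq0 ?psi_oppr // hopp0.
have [k0|[u uE]] := hunitP (res h (Some k)).
  by have := res_neq0 kh; rewrite k0 eqxx.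
have := resK kh; rewrite uE lam_val => -[<-]; rewrite -mulgA -gmulfM.
by rewrite -lam_val lamK /= hmulxN1.
Qed.

Let top_opp h x : top h (layering_opp x) <-> top h x.
Proof. by rewrite !top_res res_opp hopp_eq0. Qed.

Let add_sub x y z : layering_add x y z -> layering_add z (layering_opp y) x.
Proof.
have [[-> ->] -> //|[h [xyt xh yh]]] := ex_top x y.
move=> /[dup] xyz /(addP _ xyt xh yh)[zh rz].
apply/(addP (h := h)) => //; rewrite ?lev_opp //.
  have [y0|/top_res yt] := eqVneq (res h y) 0; last by right; apply/top_opp.
  left; apply/top_res; move: rz; rewrite y0 haddx0 => ->.
  by case: xyt => /top_res //; rewrite y0 eqxx.
by rewrite res_opp; split=> //; exact: hadd_sub.
Qed.

Let res_add0 h x y z : lev h x -> lev h y -> res h x = 0 -> res h y = 0 ->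
  layering_add x y z -> res h z = 0.
Proof.
move=> xh yh x0 y0 xyz; apply/eqP; case: eqP => // /eqP z0.
have := add_sub xyz => /(addP (h := h)).
case; rewrite ?lev_opp //; first by left; apply/top_res.
  exact: lev_add xyz.
move=> _; rewrite x0 res_opp y0 hopp0 haddx0 => z0'.
by rewrite -z0' eqxx in z0.
Qed.

Let ex_top3 x y z : [/\ x = None, y = None & z = None] \/
  exists h, [/\ [\/ top h x, top h y | top h z], lev h x, lev h y & lev h z].
Proof.
have tt k : top k (Some k) by exists k.
have [[-> ->]|[h [xyt xh yh]]] := ex_top x y.
  case: z => [k|]; last by left.
  by right; exists k; split; [constructor 3| | |rewrite /= lexx].
right; case: z => [k|]; last first.
  by exists h; split=> //; case: xyt; [constructor 1|constructor 2].
have [kh|hk] := leP (psi k) (psi h).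
  by exists h; split=> //; case: xyt; [constructor 1|constructor 2].
have levW t : lev h t -> lev k t.
  by case: t => //= l /le_trans; apply; exact: (ltW hk).
by exists k; split; [constructor 3|exact: levW|exact: levW|rewrite /= lexx].
Qed.

Let add_assoc x y z w t : layering_add y z t -> layering_add x t w ->
  exists2 s, layering_add x y s & layering_add s z w.
Proof.
move=> yzt xtw; have [[x0 y0 z0]|[h [xyz_top xh yh zh]]] := ex_top3 x y z.
  by move: yzt xtw; rewrite x0 y0 z0 /= => ->; exists None.
have th := lev_add yh zh yzt; have wh := lev_add xh th xtw.
have topN v : ~ top h v -> res h v = 0.
  by move=> vN; apply/eqP; case: eqP => // /eqP/top_res.
have [yz_top|yzN] := pselect (top h y \/ top h z); last first.
  have [yN zN] : ~ top h y /\ ~ top h z by split=> ?; apply: yzN; [left|right].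
  have xt : top h x by case: xyz_top.
  have t0 := res_add0 yh zh (topN _ yN) (topN _ zN) yzt.
  move: xtw => /(addP_top _ xt th)[_]; rewrite t0 haddx0 => wx.
  have <- : w = x by apply: (lam_eq wx); rewrite wx; apply/top_res.
  have wt : top h w by apply/top_res; rewrite wx; apply/top_res.
  exists w; first by apply/(addP_top _ wt yh); rewrite (topN _ yN) haddx0.
  by apply/(addP_top _ wt zh); rewrite (topN _ zN) haddx0.
have [_ ryzt] := (addP _ yz_top yh zh).1 yzt.
have [xt_top|xtN] := pselect (top h x \/ top h t); last first.
  have [xN tN] : ~ top h x /\ ~ top h t by split=> ?; apply: xtN; [left|right].
  have w0 := res_add0 xh th (topN _ xN) (topN _ tN) xtw.
  move: ryzt; rewrite (topN _ tN) => ryz.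
  have yt : top h y.
    case: yz_top => // /top_res zt; apply/top_res; move/haddxN: ryz zt => ->.
    by rewrite hopp_eq0.
  exists y; last by apply/(addP_top _ yt zh) => //; rewrite w0.
  by apply/(addP (h := h)) => //; [right|rewrite (topN _ xN) hadd0x].
have [_ rxtw] := (addP _ xt_top xh th).1 xtw.
have [s rxys rszw] := hadd_assoc ryzt rxtw.
have [s0|s0] := eqVneq s 0; last first.
  have xy_top : top h x \/ top h y.
    rewrite !top_res; have [x0|] := eqVneq (res h x) 0; [right|by left].
    by move: rxys; rewrite x0 hadd0x => <-.
  exists (lam h s); first by apply/(addP _ xy_top xh yh) => //; rewrite lamK.
  have st : top h (lam h s) by apply/top_res; rewrite lamK.
  by apply/(addP_top _ st zh) => //; rewrite lamK.
move: rxys rszw; rewrite {}s0 hadd0x => {s} rxy wz.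
have zw_top : top h z -> w = z.
  by move=> /top_res z0; apply: (lam_eq wz); rewrite wz.
have [xt|xN] := pselect (top h x).
  have [zt|zN] := pselect (top h z).
    exists None; last by rewrite add0x zw_top.
    by apply/(addP_top _ xt yh) => //; rewrite res0.
  have w0 : res h w = 0 by rewrite wz (topN _ zN).
  have [s wzs] := add_neq0 w (layering_opp z).
  have sh : lev h s by apply: lev_add wzs; rewrite ?lev_opp.
  exists s; last by have := add_sub wzs; rewrite loppK.
  apply/(addP_top _ xt yh) => //; split=> //; rewrite (_ : res h s = 0) //.
  by apply: res_add0 wzs => //; rewrite ?lev_opp // res_opp (topN _ zN) hopp0.
have y0 : res h y = 0 by move: rxy; rewrite (topN _ xN) hadd0x => <-.
have zt : top h z by case: yz_top => // /top_res; rewrite y0 eqxx.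
have [s xys] := add_neq0 x y; exists s => //.
have sh := lev_add xh yh xys.
have s0 : res h s = 0 by apply: res_add0 xys => //; exact: topN.
by apply/(addP (h := h)) => //; [right|rewrite s0 hadd0x].
Qed.

Let addA x y z : set_lift layering_add [set x] (layering_add y z) =
  set_lift layering_add (layering_add x y) [set z].
Proof.
rewrite eqEsubset; split=> w.
  rewrite /set_lift bigcup_set1 => -[t yzt xtw].
  have [s xys szw] := add_assoc yzt xtw.
  by exists s => //; exists z.
move=> [s + [_ -> +]]; rewrite addC [layering_add s z]addC => yxs zsw.
have [t zyt txw] := add_assoc yxs zsw.
by exists x => //; exists t; rewrite addC.
Qed.

Let addxN x y : layering_add x y None <-> y = layering_opp x.
Proof.
case: x => [h|]; last by rewrite add0x; split=> [<-|->].
split=> [xy0|->].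
  have [[//]|[k [xyt xk yk]]] := ex_top (Some h) y.
  move/(addP _ xyt xk yk): xy0 => -[_]; rewrite res0 => /haddxN yx.
  have x0 : res k (Some h) != 0.
    by case: xyt => /top_res //; rewrite yx hopp_eq0.
  by apply: (@lam_eq k); rewrite yx ?res_opp // hopp_eq0.
apply/(addP_top (h := h)); first by exists h.
  by rewrite lev_opp /= lexx.
by rewrite res0 res_opp; split=> //; apply/haddxN.
Qed.

Let addNx x y : layering_add y x None <-> y = layering_opp x.
Proof. by rewrite addC; exact: addxN. Qed.

Let add_rev x y z : layering_add y z x <->
  layering_add (layering_opp z) (layering_opp y) (layering_opp x).
Proof.
have aux u v w : layering_add v w u ->
    layering_add (layering_opp w) (layering_opp v) (layering_opp u).
  have [[-> ->] -> //|[h [vwt vh wh]]] := ex_top v w.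
  move=> /(addP _ vwt vh wh)[uh uvw].
  apply/(addP (h := h)); rewrite ?lev_opp //; first by rewrite !top_opp or_comm.
  by rewrite !res_opp; split=> //; exact: (hadd_rev _ _ _).1.
by split=> [/aux//|/aux]; rewrite !loppK.
Qed.

Local Notation L := (layering E).

HB.instance Definition _ := Choice.on L.

Let mulA : associative layering_mul.
Proof. by case=> [h|] [k|] [l|] //=; rewrite mulgA. Qed.
Let mul1x : left_id (Some 1) layering_mul.
Proof. by case=> [h|] //=; rewrite mul1g. Qed.
Let mulx1 : right_id (Some 1) layering_mul.
Proof. by case=> [h|] //=; rewrite mulg1. Qed.

HB.instance Definition _ := isMonoid.Build L mulA mul1x mulx1.

HB.instance Definition _ := isHypergroup.Build L
  add_neq0 addA add0x addx0 addxN addNx add_rev.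

HB.instance Definition _ := Hypergroup_isCommutative.Build L addC.

Let mulx0 x : layering_mul x None = None. Proof. by case: x. Qed.
Let mul0x x : layering_mul None x = None. Proof. by []. Qed.

Let hconj_val k (u : hunit F) :
  exists2 v : hunit F, hconj phi k (val u) = val v & phi v = phi u ^ k.
Proof.
have [|v vE] := @kerP (phi u ^ k).
  by rewrite /conjg !gmulfM psi_phi mul1g psiV mulVg.
exists (xget u [set v | phi v = phi u ^ k]); first by rewrite /hconj valK.
by apply: (@xgetPex _ u [set v | phi v = phi u ^ k]); exists v.
Qed.

Let lamM h k a : layering_mul (lam h a) (Some k) = lam (h * k) (hconj phi k a).
Proof.
have [_ f0 _ _ _] := ext_stable E k.
have [->|[u ->]] := hunitP a; first by rewrite f0 !lam0.
have [v -> phiv] := hconj_val k u.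
by rewrite !lam_val /= phiv /conjg !mulgA mulgK.
Qed.

Let Mlam h k a : layering_mul (Some k) (lam h a) = lam (k * h) a.
Proof.
by have [->|[u ->]] := hunitP a; rewrite ?lam0 // !lam_val /= mulgA.
Qed.

Let le_mulgE g g1 g2 : ((g * g1 <= g * g2)%O = (g1 <= g2)%O) *
  ((g1 * g <= g2 * g)%O = (g1 <= g2)%O).
Proof.
split; apply/idP/idP; [|exact: le_mulg2l| |exact: le_mulg2r].
  by move=> /(le_mulg2l g^-1); rewrite !mulKg.
by move=> /(le_mulg2r g^-1); rewrite !mulgK.
Qed.

Let res_mull h k x : res (k * h) (layering_mul (Some k) x) = res h x.
Proof.
case: x => [l|]; last by rewrite !res0.
have [lh|lh] := eqVneq (psi l) (psi h).
  by rewrite -(resK lh) Mlam !lamK.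
by rewrite !res_eq0 // !gmulfM (inj_eq (mulgI _)).
Qed.

Let res_mulr h k x :
  res (h * k) (layering_mul x (Some k)) = hconj phi k (res h x).
Proof.
have [_ f0 _ _ _] := ext_stable E k.
case: x => [l|]; last by rewrite !res0.
have [lh|lh] := eqVneq (psi l) (psi h).
  by rewrite -(resK lh) lamM !lamK.
by rewrite !res_eq0 // !gmulfM (inj_eq (mulIg _)).
Qed.

Let lev_mull h k x : lev (k * h) (layering_mul (Some k) x) = lev h x.
Proof. by case: x => //= l; rewrite !gmulfM le_mulgE. Qed.

Let lev_mulr h k x : lev (h * k) (layering_mul x (Some k)) = lev h x.
Proof. by case: x => //= l; rewrite !gmulfM le_mulgE. Qed.

Let add_mull k x y z : layering_add x y z -> layering_add
  (layering_mul (Some k) x) (layering_mul (Some k) y) (layering_mul (Some k) z).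
Proof.
have [[-> ->] ->//|[h [xyt xh yh]]] := ex_top x y.
move=> /(addP _ xyt xh yh) xyz.
apply/(addP (h := k * h)); rewrite ?lev_mull ?res_mull //.
by rewrite !top_res !res_mull -!top_res.
Qed.

Let add_mulr k x y z : layering_add x y z -> layering_add
  (layering_mul x (Some k)) (layering_mul y (Some k)) (layering_mul z (Some k)).
Proof.
have [[-> ->] ->//|[h [xyt xh yh]]] := ex_top x y.
move=> /(addP _ xyt xh yh)[zh xyz].
have [f_bij f0 _ _ fD] := ext_stable E k.
apply/(addP (h := h * k)); rewrite ?lev_mulr ?res_mulr //.
  by rewrite !top_res !res_mulr -{1 2}f0 !(inj_eq (bij_inj f_bij)) -!top_res.
by split=> //; rewrite -fD; exists (res h z).
Qed.

Let mulDr (a x y : L) : [set a * z | z in x ⊞ y] = (a * x) ⊞ (a * y).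
Proof.
case: a => [k|]; last first.
  have [t xyt] := hadd_neq0 x y.
  by rewrite eqEsubset; split=> [_ [z _ <-]//|_ ->]; exists t.
have kK : cancel (layering_mul (Some k)) (layering_mul (Some k^-1)).
  by case=> [l|//]; exact: (congr1 Some (mulKg k l)).
rewrite eqEsubset; split=> [_ [z xyz <-]|z xyz]; first exact: add_mull.
exists (layering_mul (Some k^-1) z).
  by have := add_mull k^-1 xyz; rewrite !kK.
by case: z xyz => [l _|//]; exact: (congr1 Some (mulVKg k l)).
Qed.

Let mulDl (a x y : L) : [set z * a | z in x ⊞ y] = (x * a) ⊞ (y * a).
Proof.
case: a => [k|]; last first.
  have [t xyt] := hadd_neq0 x y; rewrite /mul /= !mulx0.
  by rewrite eqEsubset; split=> [_ [z _ <-]|_ ->]; [exact: mulx0|exists t].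
have kK : cancel (layering_mul^~ (Some k)) (layering_mul^~ (Some k^-1)).
  by case=> [l|//]; exact: (congr1 Some (mulgK k l)).
rewrite eqEsubset; split=> [_ [z xyz <-]|z xyz]; first exact: add_mulr.
exists (layering_mul z (Some k^-1)).
  by have := add_mulr k^-1 xyz; rewrite !kK.
by case: z xyz => [l _|//]; exact: (congr1 Some (mulgVK k l)).
Qed.

HB.instance Definition _ := Monoid_isSkewHyperring.Build L
  mulx0 mul0x mulDr mulDl.

Let neq01 : (None : L) <> Some 1. Proof. by []. Qed.

Let invertible x : x <> None ->
  exists y, layering_mul x y = Some 1 /\ layering_mul y x = Some 1.
Proof.
by case: x => // h _; exists (Some h^-1); rewrite /= mulgV mulVg.
Qed.

HB.instance Definition _ :=
  SkewHyperring_isSkewHyperfield.Build L neq01 invertible.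

End Layering.

Definition krasner_layering (R : skewHyperfieldType) : Prop :=
  exists (F : skewHyperfieldType) (d : Order.disp_t) (G : orderedGroupType d)
         (E : stable_extension F G),
    hyperfield_isomorphic F krasner /\ hyperfield_isomorphic R (layering E).

Definition sign_layering (R : skewHyperfieldType) : Prop :=
  exists (F : skewHyperfieldType) (d : Order.disp_t) (G : orderedGroupType d)
         (E : stable_extension F G),
    hyperfield_isomorphic F sign /\ hyperfield_isomorphic R (layering E).

Definition is_skew_field (F : skewHyperfieldType) : Prop :=
  exists (D : unitRingType) (fD : GRing.field_axiom D),
    hyperfield_isomorphic F (hyperfield_of fD).

Definition skew_field_layering (R : skewHyperfieldType) : Prop :=
  exists (F : skewHyperfieldType) (d : Order.disp_t) (G : orderedGroupType d)
         (E : stable_extension F G),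
    [/\ is_skew_field F,
        [set a * b | a in [set a : G | (a < 1)%O] & b in [set b : G | (b < 1)%O]]
          = [set c : G | (c < 1)%O] &
        hyperfield_isomorphic R (layering E)].

(* Main.v *)
(* Write D = 1 ⊟ 1. If 0 is not in a ⊞ b, and c and cy are both in a ⊞ b, then
   the expansion of (a ⊞ b)(1 ⊟ y) contains 0, so 0 ∈ 1 ⊟ y and y = 1: all sums
   but those of the form x ⊟ x are singletons. Under this condition, double
   distributivity amounts to D ⊞ D = D D and, as D ⊞ D = D, to D ⊆ D D.
   The sets hD with h ≠ 0 form a chain under inclusion, and they are the
   elements of the ordered group G. If 1 ∈ D, only 1 and -1 satisfy hD = D;
   together with 0 they form the Krasner or the sign hyperfield. If 1 ∉ D, the h
   with hD = D form a skew field together with 0, the nonzero elements of D are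
   those of value less than 1, and D ⊆ D D is the condition on G. *)
From HB Require Import structures.
Require Import Defs.
From mathcomp Require Import all_boot all_order ssralg.
From mathcomp Require Import generic_quotient boolp classical_sets.

Set Implicit Arguments.
Unset Strict Implicit.
Unset Printing Implicit Defensive.

Import Order.TTheory GRing.Theory.

Local Open Scope quotient_scope.
Local Open Scope group_scope.
Local Open Scope classical_set_scope.
Local Open Scope hyper_scope.

(** * The ordered quotient of a group by a cone *)

Section OrderedQuotient.
Variables (H : groupType) (P : set H).
Hypothesis PM : forall h k, P h -> P k -> P (h * k).
Hypothesis PJ : forall h k, P h -> P (h ^ k).
Hypothesis PV : forall h, P h \/ P h^-1.

Let P1 : P 1. Proof. by case: (PV 1); rewrite ?invg1. Qed.

(** The set [P] plays the part of the elements that are at most 1, so [Q h k] reads as h ≤ k. This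
    is a total preorder, invariant under translations on both sides, and the quotient by its
    equivalence [e] is the ordered group. *)
Let Q h k := `[< P (k^-1 * h) >].

Let Qrefl : reflexive Q. Proof. by move=> h; apply/asboolP; rewrite mulVg. Qed.

Let Qtrans : transitive Q.
Proof.
move=> k h l /asboolP hk /asboolP kl; apply/asboolP.
by have := PM kl hk; rewrite mulgA mulgK.
Qed.

Let QMl l h k : Q h k -> Q (l * h) (l * k).
Proof. by rewrite /Q invgM -mulgA mulKg. Qed.

Let QMr l h k : Q h k -> Q (h * l) (k * l).
Proof.
move=> /asboolP hk; apply/asboolP.
by have := @PJ _ l hk; rewrite conjgE invgM !mulgA.
Qed.

Let e h k := Q h k && Q k h.

Let e_refl : reflexive e. Proof. by move=> h; rewrite /e !Qrefl. Qed.
Let e_sym : symmetric e. Proof. by move=> h k; rewrite /e andbC. Qed.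
Let e_trans : transitive e.
Proof.
move=> k h l /andP[hk kh] /andP[kl lk].
by rewrite /e (Qtrans hk kl) (Qtrans lk kh).
Qed.

Canonical cone_equiv := EquivRel e e_refl e_sym e_trans.

Definition cone_quotient := {eq_quot e}.
Local Notation G := cone_quotient.

HB.instance Definition _ := Choice.on G.

Let cls (h : H) : G := \pi_{eq_quot e} h.
Let rep (g : G) : H := repr g.

Let repK : cancel rep cls. Proof. exact: reprK. Qed.

Let clsP h k : cls h = cls k <-> e h k.
Proof. by split=> [/eqmodP|hk]//; apply/eqmodP. Qed.

Let rep_cls h : e (rep (cls h)) h. Proof. by apply/clsP; rewrite repK. Qed.

Let eM h h' k k' : e h h' -> e k k' -> e (h * k) (h' * k').
Proof.
move=> /andP[hh' h'h] /andP[kk' k'k]; apply/andP; split.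
  exact: Qtrans (QMr _ hh') (QMl _ kk').
exact: Qtrans (QMr _ h'h) (QMl _ k'k).
Qed.

Let mulG (g g' : G) : G := cls (rep g * rep g').
Let invG (g : G) : G := cls (rep g)^-1.

Let clsM h k : cls (h * k) = mulG (cls h) (cls k).
Proof. by apply/clsP; rewrite e_sym; exact: eM. Qed.

Let mulGA : associative mulG.
Proof.
by move=> a b c; rewrite -(repK a) -(repK b) -(repK c) -!clsM mulgA.
Qed.
Let mul1G : left_id (cls 1) mulG.
Proof. by move=> a; rewrite -(repK a) -clsM mul1g. Qed.
Let mulG1 : right_id (cls 1) mulG.
Proof. by move=> a; rewrite -(repK a) -clsM mulg1. Qed.
Let mulVG : left_inverse (cls 1) invG mulG.
Proof. by move=> a; rewrite -{2}(repK a) /invG -clsM mulVg. Qed.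
Let mulGV : right_inverse (cls 1) invG mulG.
Proof. by move=> a; rewrite -{1}(repK a) /invG -clsM mulgV. Qed.

HB.instance Definition _ := isGroup.Build G mulGA mul1G mulG1 mulVG mulGV.

Let leG (g g' : G) := Q (rep g) (rep g').

Let leG_cls h k : leG (cls h) (cls k) = Q h k.
Proof.
have /andP[hr rh] := rep_cls h; have /andP[kr rk] := rep_cls k.
apply/idP/idP => [hk|hk].
  exact: Qtrans (Qtrans rh hk) kr.
exact: Qtrans (Qtrans hr hk) rk.
Qed.

Let leG_refl : reflexive leG. Proof. by move=> g; exact: Qrefl. Qed.
Let leG_anti : antisymmetric leG.
Proof. by move=> a b ab; rewrite -(repK a) -(repK b); apply/clsP. Qed.
Let leG_trans : transitive leG. Proof. by move=> b a c; exact: Qtrans. Qed.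
Let leG_total : total leG.
Proof.
move=> a b; rewrite /leG /Q; have [ba|] := PV ((rep b)^-1 * rep a).
  by rewrite asboolT.
by rewrite invgM invgK => ?; rewrite orbC asboolT.
Qed.

HB.instance Definition _ :=
  Order.Le_isPOrder.Build (Order.Disp tt tt) G leG_refl leG_anti leG_trans.
HB.instance Definition _ :=
  Order.POrder_isTotal.Build (Order.Disp tt tt) G leG_total.

Let leG_mul2l (z x y : G) : (x <= y)%O -> (z * x <= z * y)%O.
Proof.
by rewrite -(repK x) -(repK y) -(repK z) -[_ * _]clsM -[cls _ * _]clsM;
  rewrite /Order.le /= !leG_cls; exact: QMl.
Qed.

Let leG_mul2r (z x y : G) : (x <= y)%O -> (x * z <= y * z)%O.
Proof.
by rewrite -(repK x) -(repK y) -(repK z) -[_ * _]clsM -[cls _ * _]clsM;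
  rewrite /Order.le /= !leG_cls; exact: QMr.
Qed.

HB.instance Definition _ :=
  isTranslationInvariant.Build (Order.Disp tt tt) G leG_mul2l leG_mul2r.

HB.instance Definition _ := isMultiplicative.Build H G cls clsM.

Lemma ordered_quotient :
  exists (d : Order.disp_t) (G : orderedGroupType d)
    (psi : {multiplicative H -> G}),
  range psi = setT /\ forall h, (psi h <= 1)%O <-> P h.
Proof.
exists (Order.Disp tt tt), G, cls; split=> [|h].
  by rewrite eqEsubset; split=> // g _; exists (rep g).
have -> : (cls h <= 1)%O = Q h 1 by exact: leG_cls.
by rewrite /Q invg1 mul1g; split=> /asboolP.
Qed.

End OrderedQuotient.

(** * Arithmetic of skew hyperfields and stringency *)

Definition stringent (R : skewHyperfieldType) :=
  forall x y z t : R, y <> - x -> (x ⊞ y) z -> (x ⊞ y) t -> z = t.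

Section Hyperfield.
Variable R : skewHyperfieldType.
Local Notation N1 := (- (1 : R)).
Local Notation D := ((1 : R) ⊞ N1).
Implicit Types (x y z t a b c u v w : R) (h k : hunit R).

Lemma hmulN1x x : - (1 : R) * x = - x.
Proof.
apply/haddxN; rewrite -[x in x ⊞ _]mul1g -hmulDl.
by exists 0; [exact/haddxN | exact: hmul0x].
Qed.

Lemma hmulxN x y : x * - y = - (x * y).
Proof. by rewrite -hmulxN1 mulgA hmulxN1. Qed.

Lemma hmulNx x y : - x * y = - (x * y).
Proof. by rewrite -hmulN1x -mulgA hmulN1x. Qed.

Lemma hmulI a : a != 0 -> injective (mul a).
Proof.
move=> /hinvP[_ aV] x y /(congr1 (mul (hinv a))).
by rewrite !mulgA aV !mul1g.
Qed.

Lemma hunitVK h : val h^-1 * val h = 1.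
Proof. exact: (congr1 val (mulVg h)). Qed.

Lemma hunitKV h : val h * val h^-1 = 1.
Proof. exact: (congr1 val (mulgV h)). Qed.

Lemma haddMl a x y z : (x ⊞ y) z -> (a * x ⊞ a * y) (a * z).
Proof. by move=> xyz; rewrite -hmulDr; exists z. Qed.

Lemma haddMr a x y z : (x ⊞ y) z -> (x * a ⊞ y * a) (z * a).
Proof. by move=> xyz; rewrite -hmulDl; exists z. Qed.

Lemma haddMlE a x y z : a != 0 -> (a * x ⊞ a * y) (a * z) <-> (x ⊞ y) z.
Proof.
by move=> a0; split=> [|/haddMl//]; rewrite -hmulDr => -[t xyt /(hmulI a0) <-].
Qed.

(** Normalises a sum to one whose left summand is 1. The inverse is an argument instead of [hinv x],
    so that the lemma serves R, F and a layering alike. *)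
Lemma hadd_divl x x' y z : x' * x = 1 ->
  (x ⊞ y) z <-> (1 ⊞ x' * y) (x' * z).
Proof.
move=> xV; rewrite -xV haddMlE //; apply/eqP => x0.
by move: xV; rewrite x0 hmul0x => /hzero_neq1.
Qed.

Lemma haddN x y z : (x ⊞ y) z -> (- x ⊞ - y) (- z).
Proof. by move=> /(haddMl (- (1 : R))); rewrite !hmulN1x. Qed.

Lemma haddNE x : x ⊞ - x = [set x * z | z in D].
Proof. by rewrite hmulDr mulg1 hmulxN1. Qed.

Lemma haddNEr x : x ⊞ - x = [set z * x | z in D].
Proof. by rewrite hmulDl mul1g hmulN1x. Qed.

Lemma nullN z : D z -> D (- z).
Proof. by move=> /haddN; rewrite hoppK haddC. Qed.

Lemma null0 : D 0. Proof. exact/haddxN. Qed.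

(** By reversibility [- 1] changes sides. Membership in D is mostly used in this form: adding z to 1
    can return 1. *)
Lemma nullP z : D z <-> (1 ⊞ z) 1.
Proof.
by split=> [|]; [|rewrite haddC] => /hadd_sub //; rewrite hoppK haddC.
Qed.

(** Both sides are the sum of all four elements, rebracketed by associativity and commutativity; the
    right-hand side has the bracketing of [doubly_distributive]. *)
Lemma set_lift_interchange x y z t :
  (x ⊞ y) `⊞` (z ⊞ t) = (x ⊞ z) `⊞` [set y] `⊞` [set t].
Proof.
rewrite eqEsubset; split=> w.
  move=> [p xyp [q ztq pqw]].
  have [m pzm mtw] := hadd_assoc ztq pqw.
  rewrite haddC in xyp.
  have [s xzs] := hadd_assocr xyp pzm; rewrite haddC => sym.
  by exists m; [exists s => //; exists y|exists t].
move=> [m [s xzs [_ -> sym]] [_ -> mtw]].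
rewrite haddC in sym; have [p yxp pzm] := hadd_assoc xzs sym.
have [q ztq pqw] := hadd_assocr pzm mtw.
by exists p; [rewrite haddC|exists q].
Qed.

Lemma set_liftACA x y z t :
  (x ⊞ y) `⊞` (z ⊞ t) = (x ⊞ z) `⊞` (y ⊞ t).
Proof.
have sub (p q r s : R) : (p ⊞ q) `⊞` (r ⊞ s) `<=` (p ⊞ r) `⊞` (q ⊞ s).
  rewrite set_lift_interchange => w [m [u pru [_ -> uqm]] [_ -> msw]].
  by have [v qsv uvw] := hadd_assocr uqm msw; exists u => //; exists v.
by rewrite eqEsubset; split; exact: sub.
Qed.

(** Grouped this way, the two brackets are (a ⊞ b)c and (a ⊞ b)d, so one-sided distributivity
    applies to each. *)
Lemma doubly_distributiveE : doubly_distributive R <->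
  forall a b c d : R, [set x * y | x in a ⊞ b & y in c ⊞ d] =
    (a * c ⊞ b * c) `⊞` (a * d ⊞ b * d).
Proof.
by split=> dd a b c d; have := dd a b c d; rewrite set_lift_interchange.
Qed.

(* The product set contains 0 only if 1 ⊟ u does, that is only if u = 1. *)
Lemma doubly_distributive_stringent : doubly_distributive R -> stringent R.
Proof.
move=> /doubly_distributiveE dd x y z t xy xyz xyt.
have nz s : (x ⊞ y) s -> s != 0.
  by move=> xys; apply/eqP => s0; apply/xy/haddxN; rewrite -s0.
have [tV _] := hinvP (nz t xyt).
pose u := hinv t * z; have zE : z = t * u by rewrite mulgA tV mul1g.
have /esym/seteqP[+ _] := dd x y 1 (- u).
have : ((x * 1 ⊞ y * 1) `⊞` (x * - u ⊞ y * - u)) 0.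
  exists z; first by rewrite !mulg1.
  by exists (t * - u); [exact: haddMr|rewrite hmulxN -zE; exact/haddxN].
move=> /[swap] /[apply] -[s xys [v uv sv0]].
have v0 : v = 0.
  have [//|v0] := eqVneq v 0.
  by move: (hmul_neq0 (nz s xys) v0); rewrite sv0 eqxx.
move: uv; rewrite v0 => /haddxN /(congr1 hopp); rewrite !hoppK => u1.
by rewrite zE u1 mulg1.
Qed.

(** * The difference set D of a stringent hyperfield *)

Section Stringent.
Hypothesis stR : stringent R.

(** By [nullP] the sum contains 1, and stringency leaves no second element unless z is [- 1]. *)
Lemma hadd_null1 z t : D z -> z <> N1 -> (1 ⊞ z) t -> t = 1.
Proof. by move=> /nullP Dz z1 zt; exact: (stR z1). Qed.

(** When neither z nor w is [- 1], associativity gives (1 ⊞ z) ⊞ w = {1}, so every t in z ⊞ w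
    satisfies 1 ∈ 1 ⊞ t. Summands equal to [- 1] are treated separately, with 1 = - 1 as a further
    case. *)
Lemma null_add z w t : D z -> D w -> (z ⊞ w) t -> D t.
Proof.
have aux z' w' t' : z' <> N1 -> D z' -> D w' -> (z' ⊞ w') t' -> D t'.
  move=> z1 Dz Dw zwt; have [w1|w1] := pselect (w' = N1).
    have [z1'|z1'] := pselect (z' = 1); first by rewrite z1' w1 in zwt.
    suff -> : t' = w' by [].
    move: zwt; rewrite w1 => /haddN; rewrite hoppK haddC => zt.
    rewrite -[t']hoppK (hadd_null1 (nullN Dz) _ zt) //.
    by move=> /(congr1 hopp); rewrite !hoppK.
  apply/nullP; have [s ts] := hadd_neq0 1 t'.
  have [u zu uw] := hadd_assoc zwt ts.
  by move: uw ts; rewrite (hadd_null1 Dz z1 zu) => /(hadd_null1 Dw w1) ->.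
move=> Dz Dw zwt.
have [z1|z1] := pselect (z = N1); last exact: (aux z w).
have [w1|w1] := pselect (w = N1); last by apply: (aux w z) => //; rewrite haddC.
move: zwt; rewrite z1 w1 => t1.
have [e1|e1] := pselect (N1 = 1 :> R); first by move: t1; rewrite {1}e1.
have <- : N1 = t.
  apply: (@stR N1 N1) t1; first by rewrite hoppK.
  by rewrite z1 in Dz; move/nullP/haddN: (nullN Dz); rewrite hoppK.
by rewrite z1 in Dz.
Qed.

(** The product zw lies in z(1 ⊟ 1) = z ⊟ z, a sum of two elements of D. *)
Lemma null_mul z w : D z -> D w -> D (z * w).
Proof.
move=> Dz; rewrite /= => /(haddMl z); rewrite mulg1 hmulxN1 => zz.
exact: null_add Dz (nullN Dz) zz.
Qed.

(* Write v for the only element of 1 ⊞ u, so that v ⊟ 1 = {u}. As - 1 lies in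
   - 1 ⊞ z for z in D, associativity gives u ∈ u ⊞ z. *)
Lemma null_total u : u != 0 -> D u \/ forall z, D z -> D (hinv u * z).
Proof.
move=> u0; have [|Du] := pselect (D u); first by left.
right=> z Dz; have [Vu uV] := hinvP u0.
have [u1|u1] := pselect (u = N1).
  have -> : hinv u = N1 by apply: (hmulI u0); rewrite Vu u1 hmulxN1 hoppK.
  by rewrite hmulN1x; exact: nullN.
suff uzu : (u ⊞ z) u by apply/nullP; rewrite -uV; exact: haddMl.
have [v uv] := hadd_neq0 1 u.
have N1z : (N1 ⊞ z) N1 by move/nullP/haddN: (nullN Dz); rewrite hoppK.
have vu : (v ⊞ N1) u by apply: hadd_sub; rewrite haddC.
have [s vs szu] := hadd_assoc N1z vu.
suff su : s = u by rewrite su in szu.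
apply: (@stR v N1) vs vu => /(congr1 hopp); rewrite !hoppK => v1.
by apply: Du; apply/nullP; rewrite -v1 in uv.
Qed.

End Stringent.

(** The inclusion D ⊆ DD comes from a = c = 1, b = d = - 1, where the expansion D ⊞ D contains D.
    Conversely, a sum that is not of the form x ⊟ x is a singleton, which leaves only (a ⊟ a)(c ⊟ c)
    to expand. *)
Lemma doubly_distributiveP : doubly_distributive R <->
  stringent R /\ D `<=` [set x * y | x in D & y in D].
Proof.
split=> [dd|[stR Dsub]].
  split; first exact: doubly_distributive_stringent.
  move/doubly_distributiveE: dd => -> z Dz; rewrite !mulg1.
  exists z => //; exists 0; last by rewrite haddx0.
  by rewrite mul1g hmulN1x; exact/haddxN.
apply/doubly_distributiveE => a b c d; rewrite eqEsubset; split=> [w|w].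
  move=> [x abx [y cdy <-]].
  exists (x * c); first exact: haddMr.
  by exists (x * d); [exact: haddMr|exact: haddMl].
have [ba|ba] := pselect (b = - a); last first.
  (* Here a ⊞ b has a single element, so both brackets have the same left factor x and merge by
     distributivity. *)
  rewrite -!hmulDl => -[_ [x abx <-] [_ [y aby <-]]].
  rewrite (stR _ _ _ _ ba aby abx) -hmulDr => -[t cdt <-].
  by exists x => //; exists t.
have [dc|dc] := pselect (d = - c); last first.
  rewrite set_liftACA -!hmulDr => -[_ [x cdx <-] [_ [y cdy <-]]].
  rewrite (stR _ _ _ _ dc cdy cdx) -hmulDl => -[t abt <-].
  by exists t => //; exists x.
rewrite ba dc !hmulxN !hmulNx hoppK.
move=> [p + [q + +]]; rewrite [- _ ⊞ _]haddC !(haddNE (a * c)).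
move=> [y Dy <-] [z Dz <-]; rewrite -hmulDr => -[t yzt <-].
have [u Du [v Dv uvt]] := Dsub _ (null_add stR Dy Dz yzt).
(* As cD = Dc, the factor u passes to the left of c, and acuv becomes (au')(cv). *)
have [u' Du' u'c] : [set x * c | x in D] (c * u).
  by rewrite -haddNEr haddNE; exists u.
exists (a * u'); first by rewrite haddNE; exists u'.
exists (c * v); first by rewrite haddNE; exists v.
by rewrite -uvt !mulgA -(mulgA a c u) -u'c !mulgA.
Qed.

End Hyperfield.

(** * Invariance under isomorphism *)

Section Isomorphism.
Variables (R S : skewHyperfieldType) (f : R -> S).
Hypothesis isof : hyperfield_isomorphism f.

Lemma iso_hadd x y z : (f x ⊞ f y) (f z) <-> (x ⊞ y) z.
Proof.
have [/bij_inj f_inj _ _ _ fD] := isof; rewrite -fD.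
by split=> [[t xyt /f_inj <-]|xyz] //; exists z.
Qed.

Lemma iso_hopp x : f (- x) = - f x.
Proof.
have [_ f0 _ _ _] := isof; apply/haddxN; rewrite -f0.
exact/iso_hadd/haddxN.
Qed.

Lemma iso_null z : ((1 : S) ⊞ - (1 : S)) (f z) <-> ((1 : R) ⊞ - (1 : R)) z.
Proof. by have [_ _ <- _ _] := isof; rewrite -iso_hopp; exact: iso_hadd. Qed.

Lemma iso_stringent : stringent S -> stringent R.
Proof.
have [/bij_inj f_inj _ _ _ _] := isof.
move=> st x y z t xy /iso_hadd xyz /iso_hadd xyt.
by apply/f_inj/(st _ _ _ _ _ xyz xyt); rewrite -iso_hopp => /f_inj.
Qed.

(** By [doubly_distributiveP] it suffices to transport stringency and the inclusion D ⊆ DD. *)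
Lemma iso_doubly_distributive : doubly_distributive S -> doubly_distributive R.
Proof.
have [/[dup] /bij_inj f_inj [g gK fK] _ _ fM _] := isof.
move=> /doubly_distributiveP[st sub]; apply/doubly_distributiveP.
split=> [|z /iso_null/sub]; first exact: iso_stringent.
move=> [u + [v + uvz]]; rewrite -(fK u) -(fK v) => /iso_null Du /iso_null Dv.
by exists (g u) => //; exists (g v) => //; apply: f_inj; rewrite fM !fK.
Qed.

Lemma iso_hopp1 : - (1 : S) = 1 <-> - (1 : R) = 1.
Proof.
have [/bij_inj f_inj _ f1 _ _] := isof; rewrite -f1 -iso_hopp.
by split=> [/f_inj|->].
Qed.

End Isomorphism.

Lemma hunitP (F : skewHyperfieldType) (a : F) :
  a = 0 \/ exists u : hunit F, a = val u.
Proof.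
by have [->|a0] := eqVneq a 0; [left|right; exists (Sub a a0); rewrite SubK].
Qed.

(** * Sums and the difference set in a layering *)

Section LayeringTheory.
Variables (F : skewHyperfieldType) (d : Order.disp_t) (G : orderedGroupType d).
Variable E : stable_extension F G.

Local Notation H := (ext_group E).
Local Notation L := (layering E).
Local Notation phi := (@ext_incl F d G E).
Local Notation psi := (@ext_proj F d G E).
Local Notation lam := (layer_map phi).

Implicit Types (h k l : H) (a b c : F).

Lemma layer_map0 h : lam h 0 = None.
Proof. by rewrite /layer_map insubF ?eqxx. Qed.

Lemma layer_map_val h (u : hunit F) : lam h (val u) = Some (h * phi u).
Proof. by rewrite /layer_map valK. Qed.

Lemma multiplicative1 (K K' : groupType) (f : {multiplicative K -> K'}) :
  f 1 = 1.
Proof. by apply: (mulgI (f 1)); rewrite -gmulfM !mulg1. Qed.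

Lemma layer_map1 h : lam h 1 = Some h.
Proof. by have := layer_map_val h 1; rewrite multiplicative1 mulg1. Qed.

Lemma psi_phi u : psi (phi u) = 1.
Proof.
case: (ext_exact E) => _ + _ => /seteqP[+ _] => /(_ (phi u)).
by apply; exists u.
Qed.

Lemma layer_map_inj h : injective (lam h).
Proof.
have [phi_inj _ _] := ext_exact E.
move=> a b; have [->|[u ->]] := hunitP a; have [->|[v ->]] := hunitP b;
  rewrite ?layer_map0 ?layer_map_val //.
by case=> /mulgI/phi_inj->.
Qed.

Lemma psi_layer_map h k a : lam h a = Some k -> psi k = psi h.
Proof.
have [->|[u ->]] := hunitP a; first by rewrite layer_map0.
rewrite layer_map_val => -[<-].
by rewrite gmulfM psi_phi mulg1.
Qed.

Lemma layer_map_surj h k : psi k = psi h -> exists a, Some k = lam h a.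
Proof.
move=> kh; have [_ /seteqP[_ /(_ (h^-1 * k)) ker] _] := ext_exact E.
have [|u _ uE] := ker.
  by rewrite /= gmulfM kh -gmulfM mulVg multiplicative1.
by exists (val u); rewrite layer_map_val uE mulVKg.
Qed.

Lemma layering_hadd_lt (h k : H) : (psi h < psi k)%O ->
  (Some h : L) ⊞ Some k = [set Some k].
Proof. by move=> hk; rewrite /hadd /= hk ltNge ltW. Qed.

Lemma layering_hadd_eq (h k : H) (z : L) : psi k = psi h ->
  ((Some h : L) ⊞ Some k) z ->
  (exists c, z = lam h c) \/
  ((Some h : L) ⊞ Some k) 0 /\ exists2 l, z = Some l & (psi l < psi h)%O.
Proof.
move=> kh; rewrite /hadd /= kh ltxx.
case: ifPn => /asboolP T.
  by rewrite tier_addE => -[a [b [c [_ _ _ <-]]]]; left; exists c.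
move=> [|[l lh <-]]; last first.
  by right; split; [left; exact: (contrapT T)|exists l].
by rewrite tier_addE => -[a [b [c [_ _ _ <-]]]]; left; exists c.
Qed.

(** The elements of lower tiers that the sum may also contain are not values of [lam h], so the tier
    part alone decides. *)
Lemma layering_hadd_layer h a b c :
  ((lam h a : L) ⊞ lam h b) (lam h c) <-> (a ⊞ b) c.
Proof.
have [->|a0] := eqVneq a 0.
  by rewrite layer_map0 !hadd0x; split=> [/layer_map_inj|->].
have [->|b0] := eqVneq b 0.
  by rewrite layer_map0 !haddx0; split=> [/layer_map_inj|->].
case aE : (lam h a) => [k|]; last first.
  by move/eqP: a0; case; apply: (@layer_map_inj h); rewrite aE layer_map0.
case bE : (lam h b) => [l|]; last first.
  by move/eqP: b0; case; apply: (@layer_map_inj h); rewrite bE layer_map0.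
have kh := psi_layer_map aE; have lh := psi_layer_map bE.
have TE : tier_add (psi h) (lam h a) (lam h b) (lam h c) <-> (a ⊞ b) c.
  rewrite tier_addE; split=> [[a' [b' [c' []]]]|abc]; last by exists a, b, c.
  by do 2![move=> /layer_map_inj ->] => + /layer_map_inj <-.
rewrite /hadd /= kh lh ltxx -aE -bE.
case: ifP => // _; split=> [[/TE//|[m /= mh]]|/TE]; last by left.
by move=> /esym/psi_layer_map mE; rewrite mE ltxx in mh.
Qed.

Lemma layering_hopp1 : - (1 : L) = lam 1 (- (1 : F)).
Proof.
apply/esym/haddxN; have <- : lam 1 1 = (1 : L) by exact: layer_map1.
have <- : lam 1 0 = (0 : L) by exact: layer_map0.
by apply/layering_hadd_layer/haddxN.
Qed.

Lemma layering_null1 :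
  ((1 : L) ⊞ - (1 : L)) 1 <-> ((1 : F) ⊞ - (1 : F)) 1.
Proof.
rewrite layering_hopp1; have <- : lam 1 1 = (1 : L) by exact: layer_map1.
exact: layering_hadd_layer.
Qed.

Lemma layering_hopp1_eq1 : - (1 : L) = 1 <-> - (1 : F) = 1.
Proof.
rewrite layering_hopp1; have <- : lam 1 1 = (1 : L) by exact: layer_map1.
by split=> [/layer_map_inj|->].
Qed.

(** Summands in different tiers give a singleton by definition. Within one tier, a sum of
    non-opposite elements omits 0, hence has no elements of lower tiers, and it is computed in F. *)
Lemma layering_stringent : stringent F -> stringent L.
Proof.
move=> st x y z t.
case: x => [h|]; last by move=> _; rewrite hadd0x => -> ->.
case: y => [k|]; last by move=> _; rewrite haddx0 => -> ->.
case: (ltgtP (psi h) (psi k)) => [hk|kh|/esym kh] xy.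
- by rewrite layering_hadd_lt // => -> ->.
- by rewrite haddC layering_hadd_lt // => -> ->.
have N0 : ~ ((Some h : L) ⊞ Some k) (lam h 0) by rewrite layer_map0 => /haddxN.
have [b kE] := layer_map_surj kh.
move=> /[dup] hkz /(layering_hadd_eq kh)[[c zE]|[+ _]]; last by move=> /haddxN.
move=> /[dup] hkt /(layering_hadd_eq kh)[[c' tE]|[+ _]]; last by move=> /haddxN.
move: N0 hkz hkt; rewrite zE tE kE -(layer_map1 h).
rewrite !layering_hadd_layer => N0 bc bc'.
by rewrite (st _ _ _ _ _ bc bc') // => /haddxN.
Qed.

Lemma layering_null_lt l : (psi l < 1)%O -> ((1 : L) ⊞ - (1 : L)) (Some l).
Proof.
rewrite -(multiplicative1 psi) => l1; apply/nullP.
by rewrite haddC (layering_hadd_lt l1).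
Qed.

Lemma layering_nullP (z : L) : ((1 : L) ⊞ - (1 : L)) z ->
  (exists2 c, ((1 : F) ⊞ - (1 : F)) c & z = lam 1 c) \/
  exists2 l, z = Some l & (psi l < 1)%O.
Proof.
move=> Dz; have [] := @layering_hadd_eq 1 (1 * phi (hunitN1 F)) z _ Dz.
- by rewrite mul1g psi_phi multiplicative1.
- move=> [c zE]; left; exists c => //; move: Dz.
  rewrite zE layering_hopp1; have <- : lam 1 1 = (1 : L) by exact: layer_map1.
  by move=> /layering_hadd_layer.
by rewrite multiplicative1 => -[_]; right.
Qed.

(** Since 1 lies in the difference set D of the layering, D ⊆ DD holds by z = z1. *)
Lemma layering_doubly_distributive_null1 :
  stringent F -> ((1 : F) ⊞ - (1 : F)) 1 -> doubly_distributive L.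
Proof.
move=> stF F1; apply/doubly_distributiveP.
split; first exact: layering_stringent.
by move=> z Dz; exists z => //; exists 1; [exact/layering_null1|rewrite mulg1].
Qed.

(** Here the difference set consists of 0 and the tiers below 1, so a factorisation in G is to be
    lifted to H. *)
Lemma layering_doubly_distributive_null0 :
  stringent F -> ((1 : F) ⊞ - (1 : F)) `<=` [set 0] ->
  [set a * b | a in [set a : G | (a < 1)%O] & b in [set b : G | (b < 1)%O]]
          = [set c : G | (c < 1)%O] ->
  doubly_distributive L.
Proof.
move=> stF F0 G1; apply/doubly_distributiveP.
split; first exact: layering_stringent.
move=> z /layering_nullP[[c /F0 -> ->]|[l ->]].
  by exists 0; [exact: null0|exists 0; [exact: null0|rewrite layer_map0]].
have [_ _ psi_surj] := ext_exact E.
move=> l1; have : [set c : G | (c < 1)%O] (psi l) by [].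
rewrite -G1 => -[a a1 [b b1 ab]].
have : range psi a by rewrite psi_surj.
move=> [h _ ha]; exists (Some h); first by apply: layering_null_lt; rewrite ha.
(* Only the first factor is an arbitrary lift; the second is chosen so that the product is exactly
   [l], and its value is then forced to be b. *)
exists (Some (h^-1 * l)); last by congr Some; rewrite mulVKg.
apply: layering_null_lt; suff -> : psi (h^-1 * l) = b by [].
by apply: (mulgI (psi h)); rewrite -gmulfM mulVKg ha ab.
Qed.

End LayeringTheory.

(** * The Krasner hyperfield, the sign hyperfield and skew fields *)

Lemma krasner_stringent : stringent krasner.
Proof. by case=> [] [] z t /= yx => [->|->|->|] // _ _; case: yx. Qed.

Lemma sign_stringent : stringent sign.
Proof.
by case=> [] [] z t /= yx => [->|->|->|->|->||->||->] // _ _; case: yx.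
Qed.

Lemma krasner_null1 : ((1 : krasner) ⊞ - (1 : krasner)) 1.
Proof. by right. Qed.

Lemma sign_null1 : ((1 : sign) ⊞ - (1 : sign)) 1.
Proof. by left; right. Qed.

Section SkewField.
Variables (D : unitRingType) (fD : GRing.field_axiom D).
Local Notation F := (hyperfield_of fD).

Lemma skew_field_stringent : stringent F.
Proof. by move=> x y z t _ -> ->. Qed.

Lemma skew_field_null : ((1 : F) ⊞ - (1 : F)) `<=` [set 0].
Proof. by move=> z ->; rewrite /= subrr. Qed.

End SkewField.

(** * Sums of elements of different values *)

Lemma ordered_sqr1 (d : Order.disp_t) (G : orderedGroupType d) (g : G) :
  g * g = 1 -> g = 1.
Proof.
move=> g1; case: (ltgtP g 1) => // [lt1|gt1].
  by have := le_mulg2l g _ _ (ltW lt1); rewrite g1 mulg1 leNgt lt1.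
by have := le_mulg2l g _ _ (ltW gt1); rewrite g1 mulg1 leNgt gt1.
Qed.

Section Valuation.
Variables (R : skewHyperfieldType) (d : Order.disp_t) (G : orderedGroupType d).
Variable psi : {multiplicative hunit R -> G}.
Local Notation D := ((1 : R) ⊞ - (1 : R)).

Hypothesis stR : stringent R.
Hypothesis null_lt : forall h, (psi h < 1)%O -> D (val h).

Implicit Types (h k l : hunit R).

(** The square of [- 1] is 1, and [ordered_sqr1] excludes elements of order two in G. *)
Lemma psiN1 : psi (hunitN1 R) = 1.
Proof.
apply: ordered_sqr1; rewrite -gmulfM -(multiplicative1 psi); congr (psi _).
by apply: val_inj; rewrite /= hmulxN1 hoppK.
Qed.

Lemma psi_lt1 h k : (psi h < psi k)%O -> (psi (k^-1 * h) < 1)%O.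
Proof.
move=> hk; rewrite lt_neqAle -(inj_eq (mulgI (psi k))) -gmulfM mulVKg mulg1.
rewrite lt_eqF //=; have := le_mulg2l (psi k^-1) _ _ (ltW hk).
by rewrite -!gmulfM mulVg multiplicative1.
Qed.

(** Division by k gives k^-1 h ∈ D, so k ∈ k ⊞ h. Stringency makes it the only element: h = - k
    would turn k^-1 h into [- 1], which has value 1. *)
Lemma hadd_lt h k : (psi h < psi k)%O -> val h ⊞ val k = [set val k].
Proof.
move=> /[dup] hk /psi_lt1 kh1.
have kk : (val k ⊞ val h) (val k).
  by rewrite (hadd_divl _ _ (hunitVK k)) hunitVK; exact/nullP/(null_lt kh1).
have hNk : val h <> - val k.
  move=> hE; have khN1 : k^-1 * h = hunitN1 R.
    by apply: val_inj; rewrite -[LHS]/(val k^-1 * val h) hE hmulxN hunitVK.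
  by move: kh1; rewrite khN1 psiN1 ltxx.
rewrite haddC eqEsubset; split=> [w kw|_ ->] //.
exact: stR hNk kw kk.
Qed.

End Valuation.

(** * Recognition of a layering *)

Section LayeringRecognition.
Variables (R F : skewHyperfieldType).
Variables (d : Order.disp_t) (G : orderedGroupType d).
Variable phi : {multiplicative hunit F -> hunit R}.
Variable psi : {multiplicative hunit R -> G}.
Local Notation D := ((1 : R) ⊞ - (1 : R)).

Hypothesis stR : stringent R.
Hypothesis exact_phi_psi : short_exact phi psi.
Hypothesis haddD : forall u v,
  ((1 : R) ⊞ val (phi u)) (val (phi v)) <-> ((1 : F) ⊞ val u) (val v).
Hypothesis haddN1 : forall u, val (phi u) = - (1 : R) <-> val u = - (1 : F).
Hypothesis null_lt : forall h, (psi h < 1)%O -> D (val h).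
Hypothesis null_le : forall h, D (val h) -> (psi h <= 1)%O.

Implicit Types (h k l : hunit R) (u v : hunit F) (a b c : F) (x y z : R).

(** The map [phi] extended by 0 ↦ 0, an embedding of F into R. A sum in R of two of its values may
    also contain elements outside its range. *)
Let emb a : R := oapp (val \o phi) (0 : R) (insub a).

Let emb0 : emb 0 = 0.
Proof. by rewrite /emb insubF ?eqxx. Qed.

Let emb_val u : emb (val u) = val (phi u).
Proof. by rewrite /emb valK. Qed.

Let emb1 : emb 1 = 1.
Proof. by rewrite (emb_val 1) multiplicative1. Qed.

Let embM a b : emb (a * b) = emb a * emb b.
Proof.
have [->|[u ->]] := hunitP a; first by rewrite hmul0x emb0 hmul0x.
have [->|[v ->]] := hunitP b; first by rewrite hmulx0 emb0 hmulx0.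
by rewrite (emb_val (u * v)) gmulfM !emb_val.
Qed.

Let emb_inj : injective emb.
Proof.
have [phi_inj _ _] := exact_phi_psi.
move=> a b; have [->|[u ->]] := hunitP a; have [->|[v ->]] := hunitP b;
  rewrite ?emb0 ?emb_val //.
- by move=> E; have := valP (phi v); rewrite -E eqxx.
- by move=> E; have := valP (phi u); rewrite E eqxx.
by move=> /val_inj/phi_inj->.
Qed.

Let emb_hadd1 u c : (1 ⊞ emb (val u)) (emb c) <-> (1 ⊞ val u) c.
Proof.
have [->|[v ->]] := hunitP c; last by rewrite !emb_val; exact: haddD.
rewrite emb0 emb_val; split=> /haddxN E; apply/haddxN.
  exact/haddN1.
exact/haddN1.
Qed.

Let emb_hadd a b c : (emb a ⊞ emb b) (emb c) <-> (a ⊞ b) c.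
Proof.
have [->|[u ->]] := hunitP a.
  by rewrite emb0 !hadd0x; split=> [/emb_inj|->].
have [->|[v ->]] := hunitP b.
  by rewrite emb0 !haddx0; split=> [/emb_inj|->].
have uK := hunitVK u.
rewrite (hadd_divl _ _ uK); apply: iff_trans (emb_hadd1 (u^-1 * v) _).
rewrite (embM (val u^-1) (val v)) embM; apply: hadd_divl.
by rewrite -embM uK emb1.
Qed.

Let emb_hopp1 : emb (- (1 : F)) = - (1 : R).
Proof. by rewrite (emb_val (hunitN1 F)); exact/haddN1. Qed.

Let stF : stringent F.
Proof.
move=> a b c c' ab /emb_hadd abc /emb_hadd abc'.
apply/emb_inj; apply: (@stR (emb a) (emb b)) abc abc' => E.
apply: ab; apply: emb_inj.
by rewrite E -(hmulN1x a) embM emb_hopp1 hmulN1x.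
Qed.

Let kerP h : psi h = 1 -> exists u, phi u = h.
Proof.
have [_ /seteqP[_ /(_ h) ker] _] := exact_phi_psi.
by move=> /ker[u _ <-]; exists u.
Qed.

Let hconj_emb h a : emb (hconj phi h a) = val h^-1 * emb a * val h.
Proof.
have [->|[u ->]] := hunitP a.
  by rewrite /hconj insubF ?eqxx // emb0 hmulx0 hmul0x.
have [_ /seteqP[/(_ (phi u)) psi_phi _] _] := exact_phi_psi.
have [|v vE] := @kerP (phi u ^ h).
  rewrite /conjg !gmulfM psi_phi ?mul1g; last by exists u.
  by rewrite -gmulfM mulVg multiplicative1.
rewrite /hconj valK.
have := @xgetPex _ u [set v | phi v = phi u ^ h].
move=> /(_ (ex_intro _ v vE)) /= wE.
by rewrite !emb_val wE /conjg /= mulgA.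
Qed.

Let hconjK h : cancel (hconj phi h) (hconj phi h^-1).
Proof.
move=> a; apply: emb_inj; rewrite !hconj_emb invgK !mulgA.
by rewrite hunitKV mul1g -mulgA hunitKV mulg1.
Qed.

Let hconj_hadd h a b c : (a ⊞ b) c ->
  (hconj phi h a ⊞ hconj phi h b) (hconj phi h c).
Proof.
move=> /emb_hadd abc; apply/emb_hadd; rewrite !hconj_emb.
exact/haddMr/haddMl.
Qed.

(** Seen through [emb], the map [hconj phi h] is x ↦ h^-1 x h in R, which preserves sums by
    distributivity on both sides. *)
Lemma stable_sums_layering : stable_sums phi.
Proof.
move=> h; have hK := hconjK h; have := hconjK h^-1; rewrite invgK => Kh.
split.
- by exists (hconj phi h^-1).
- by apply: emb_inj; rewrite hconj_emb emb0 hmulx0 hmul0x.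
- by apply: emb_inj; rewrite hconj_emb emb1 mulg1 hunitVK.
- move=> a b; apply: emb_inj; rewrite embM !hconj_emb embM !mulgA.
  by rewrite -[_ * val h * val h^-1]mulgA hunitKV mulg1.
move=> a b; rewrite eqEsubset; split=> [_ [c abc <-]|c abc].
  exact: hconj_hadd.
exists (hconj phi h^-1 c) => //.
by have := @hconj_hadd h^-1 _ _ _ abc; rewrite !hK.
Qed.

Let E : stable_extension F G :=
  StableExtension exact_phi_psi stable_sums_layering.
Local Notation L := (layering E).

(** The middle group of [E] is [hunit R] itself, so R and the layering have the same nonzero
    elements with the same products, and only the sums need comparison. *)
Let f (x : R) : L := insub x.

Let f0 : f 0 = 0. Proof. by rewrite /f insubF ?eqxx. Qed.
Let f_val h : f (val h) = Some h. Proof. exact: valK. Qed.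
Let f1 : f 1 = 1. Proof. exact: (f_val 1). Qed.

Let fM x y : f (x * y) = f x * f y.
Proof.
have [->|[h ->]] := hunitP x; first by rewrite hmul0x f0 hmul0x.
have [->|[k ->]] := hunitP y; first by rewrite hmulx0 f0 hmulx0.
by rewrite (f_val (h * k)) !f_val.
Qed.

Let f_emb c : f (emb c) = layer_map phi 1 c.
Proof.
have [->|[u ->]] := hunitP c; first by rewrite emb0 f0 (@layer_map0 _ _ _ E).
by rewrite emb_val f_val (@layer_map_val _ _ _ E) mul1g.
Qed.

Let f_bij : bijective f.
Proof.
exists (oapp val (0 : R)) => [x|].
  by have [->|[h ->]] := hunitP x; rewrite ?f0 ?f_val.
by case=> [h|]; [exact: f_val|exact: f0].
Qed.

Let psi1 : psi 1 = 1. Proof. exact: multiplicative1. Qed.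

(** An element z in the range of [emb] is decided in F. Any other z is nonzero of value different
    from 1: if u is [- 1], it lies in either sum exactly when its value is below 1; otherwise
    stringency makes both sums singletons coming from F. *)
Let f_hadd1 u z : (1 ⊞ val (phi u)) z <-> ((1 : L) ⊞ Some (phi u)) (f z).
Proof.
have f_inj := bij_inj f_bij.
have lE : Some (phi u) = layer_map phi 1 (val u) :> L.
  by rewrite -f_emb emb_val f_val.
have l1 : 1 = layer_map phi 1 1 :> L by rewrite -f_emb emb1 f1.
have [[c ->]|zN] := pselect (exists c, z = emb c).
  rewrite f_emb lE l1 -emb_val; apply: iff_trans (emb_hadd1 _ _) _.
  by apply: iff_sym; exact: layering_hadd_layer.
have [[z0]|[l zl]] := hunitP z; first by case: zN; exists 0; rewrite emb0.
have l_neq1 : psi l != 1.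
  by apply/eqP => /kerP[v vl]; apply: zN; exists (val v); rewrite emb_val vl.
have [uN1|uN1] := pselect (val u = - (1 : F)).
  have -> : Some (phi u) = - (1 : L) by rewrite lE uN1 -(layering_hopp1 E).
  rewrite (haddN1 u).2 // zl f_val; split=> [/null_le l_le|].
    by apply: layering_null_lt; rewrite lt_neqAle l_neq1.
  move=> /layering_nullP[[c _]|[_ [<-]] /null_lt //].
  by rewrite -f_emb -f_val => /f_inj cl; case: zN; exists c; rewrite zl.
have [c /[dup] /emb_hadd1 uc lc] := hadd_neq0 1 (val u).
(* As z is outside the range of [emb], each direction only has to produce the contradictory equation
   z = [emb c]. *)
have N (P : Prop) : z = emb c -> P by move=> zc; case: zN; exists c.
split=> [uz|lz]; apply: N.
  by apply: (@stR 1 (val (phi u))) uz _ => [/haddN1//|]; rewrite -emb_val.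
apply: f_inj; rewrite f_emb.
apply: (@layering_stringent _ _ _ E stF 1 (Some (phi u))) lz _.
  rewrite lE (layering_hopp1 E) => /(@layer_map_inj _ _ _ E); exact: uN1.
by rewrite lE l1; apply/(@layering_hadd_layer _ _ _ E).
Qed.

(** Summands of different values are settled by [hadd_lt] and [layering_hadd_lt]. For equal values,
    division by h reduces to the sum of 1 and an element of the range of [phi], which is
    [f_hadd1]. *)
Lemma layering_recognition :
  exists E : stable_extension F G, hyperfield_isomorphic R (layering E).
Proof.
have f_inj := bij_inj f_bij.
exists E, f; split=> //.
suff fD x y z : (f x ⊞ f y) (f z) <-> (x ⊞ y) z.
  move=> x y; rewrite eqEsubset; split=> [_ [z xyz <-]|z]; first exact/fD.
  by have [g _ gK] := f_bij; rewrite -(gK z) => /fD; exists (g z).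
have [->|[h ->]] := hunitP x.
  by rewrite f0 !hadd0x; split=> [/f_inj|->].
have [->|[k ->]] := hunitP y.
  by rewrite f0 !haddx0; split=> [/f_inj|->].
rewrite !f_val; case: (ltgtP (psi h) (psi k)) => [hk|kh|/esym kh].
- rewrite (hadd_lt stR null_lt hk) (layering_hadd_lt (E := E) hk) -f_val.
  by split=> [/f_inj|->].
- rewrite (haddC (val h)) (haddC (Some h : L)).
  rewrite (hadd_lt stR null_lt kh) (layering_hadd_lt (E := E) kh) -f_val.
  by split=> [/f_inj|->].
have [|u uE] := @kerP (h^-1 * k); first by rewrite gmulfM kh -gmulfM mulVg.
have hV : (Some h^-1 : L) * (Some h : L) = 1 by rewrite -!f_val -fM hunitVK f1.
rewrite (hadd_divl _ _ (hunitVK h)) (hadd_divl _ _ hV).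
have <- : val (phi u) = val h^-1 * val k by rewrite uE.
have <- : Some (phi u) = (Some h^-1 : L) * (Some k : L) by rewrite uE.
rewrite -(f_val h^-1) -fM.
by apply: iff_sym; exact: f_hadd1.
Qed.

End LayeringRecognition.

(** * The residue skew field *)

Section ResidueField.
Variables (R : skewHyperfieldType) (d : Order.disp_t) (G : orderedGroupType d).
Variable psi : {multiplicative hunit R -> G}.
Local Notation D := ((1 : R) ⊞ - (1 : R)).

Hypothesis stR : stringent R.
Hypothesis null_psi : forall h, D (val h) <-> (psi h < 1)%O.

Implicit Types (h k l : hunit R).

Let null_lt h : (psi h < 1)%O -> D (val h). Proof. by move=> /null_psi. Qed.

Let hadd_ltl h k : (psi h < psi k)%O -> val k ⊞ val h = [set val k].
Proof. by rewrite haddC; exact: hadd_lt. Qed.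

Definition residual (x : R) := oapp (fun h => psi h == 1) true (insub x).
Definition residue := {x : R | residual x}.

HB.instance Definition _ := SubChoice.on residue.
Local Notation T := residue.

Let residual0 : residual 0. Proof. by rewrite /residual insubF ?eqxx. Qed.
Let residual_val h : residual (val h) = (psi h == 1).
Proof. by rewrite /residual valK. Qed.

Let residual1 : residual 1.
Proof. by rewrite (residual_val 1) multiplicative1. Qed.

Let residualM x y : residual x -> residual y -> residual (x * y).
Proof.
have [->|[h ->]] := hunitP x; first by rewrite hmul0x.
have [->|[k ->]] := hunitP y; first by rewrite hmulx0.
rewrite (residual_val (h * k)) !residual_val gmulfM => /eqP -> /eqP ->.
by rewrite mulg1.
Qed.

Let residualN x : residual x -> residual (- x).
Proof.
rewrite -hmulN1x; apply: residualM.
by rewrite (residual_val (hunitN1 R)) psiN1.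
Qed.

(** Inversion in a unit ring has to fix the non-units; here 0 is the default value of [xget] in
    [hinv]. *)
Let hinv0 : hinv (0 : R) = 0.
Proof.
rewrite /hinv; case: xgetP => // y _ [+ _].
by rewrite hmul0x => /hzero_neq1.
Qed.

Let residualV x : residual x -> residual (hinv x).
Proof.
have [->|[h ->]] := hunitP x; first by rewrite hinv0.
rewrite residual_val (residual_val h^-1) => /eqP h1; apply/eqP.
by apply: (mulgI (psi h)); rewrite -gmulfM mulgV multiplicative1 h1 mulg1.
Qed.

(** For nonzero x and y with y ≠ - x, every z in the sum has value 1: x lies in z ⊟ y, which would
    be {- y} if z had a smaller value and {z} if it had a larger one. *)
Let residual_ex x y : residual x -> residual y ->
  exists2 z, (x ⊞ y) z & residual z.
Proof.
have [->|[h ->]] := hunitP x; first by exists y; rewrite ?hadd0x.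
have [->|[k ->]] := hunitP y; first by exists (val h); rewrite ?haddx0.
rewrite !residual_val => /eqP h1 /eqP k1.
have [kh|kh] := pselect (val k = - val h).
  by exists 0; [exact/haddxN|exact: residual0].
have [z hkz] := hadd_neq0 (val h) (val k); exists z => //.
have [zE|[l zl]] := hunitP z.
  by rewrite zE in hkz; case: kh; apply/haddxN.
move: hkz; rewrite zl residual_val => /hadd_sub.
have -> : - val k = val (k * hunitN1 R) by rewrite /= hmulxN1.
have kN1 : psi (k * hunitN1 R) = 1 by rewrite gmulfM psiN1 // k1 mulg1.
case: (ltgtP (psi l) 1) => // l1.
- rewrite haddC hadd_ltl ?kN1 // => hE; case: kh.
  by rewrite hE /= hmulxN1 hoppK.
- by rewrite hadd_ltl ?kN1 // => /val_inj hE; rewrite -hE h1 ltxx in l1.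
Qed.

Let hadd_opp x z : residual x -> (x ⊞ - x) z ->
  z = 0 \/ exists2 l, z = val l & (psi l < 1)%O.
Proof.
rewrite haddNE => + [t Dt <-].
have [->|[h ->]] := hunitP x; first by rewrite hmul0x; left.
have [->|[k kE]] := hunitP t; first by rewrite hmulx0; left.
rewrite residual_val => /eqP h1; right; exists (h * k); rewrite ?kE //.
by rewrite gmulfM h1 mul1g; apply/null_psi; rewrite -kE.
Qed.

(** Only the sums x ⊟ x can have several elements; the nonzero ones have value below 1, so 0 is the
    one residual element. *)
Let residual_uniq x y z t : residual x -> residual z -> residual t ->
  (x ⊞ y) z -> (x ⊞ y) t -> z = t.
Proof.
move=> rx rz rt; have [yx|yx] := pselect (y = - x); last exact: stR.
rewrite yx => /(hadd_opp rx) xz /(hadd_opp rx) xt.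
have aux w : residual w ->
    (w = 0 \/ exists2 l, w = val l & (psi l < 1)%O) -> w = 0.
  move=> rw [//|[l wl l1]].
  by move: rw l1; rewrite wl residual_val => /eqP ->; rewrite ltxx.
by rewrite (aux z) // (aux t).
Qed.

Let rzero : T := Sub 0 residual0.
Let rone : T := Sub 1 residual1.
Let rmul (x y : T) : T := Sub (val x * val y) (residualM (valP x) (valP y)).
Let ropp (x : T) : T := Sub (- val x) (residualN (valP x)).
Let rinv (x : T) : T := Sub (hinv (val x)) (residualV (valP x)).
(** The unique residual element of the sum; by [residual_ex] the default [rzero] is never a
    fallback. *)
Let radd (x y : T) : T := xget rzero [set z : T | (val x ⊞ val y) (val z)].

Let raddP (x y z : T) : (val x ⊞ val y) (val z) <-> z = radd x y.
Proof.
have raddxy : (val x ⊞ val y) (val (radd x y)).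
  have [s xys rs] := residual_ex (valP x) (valP y).
  have : exists t : T, (val x ⊞ val y) (val t) by exists (Sub s rs).
  exact: (@xgetPex _ rzero [set t : T | (val x ⊞ val y) (val t)]).
split=> [xyz|-> //]; apply: val_inj.
exact: residual_uniq (valP x) (valP z) (valP _) xyz raddxy.
Qed.

Let raddC : commutative radd.
Proof. by move=> x y; apply/raddP; rewrite haddC; apply/raddP. Qed.

Let radd0 : left_id rzero radd.
Proof. by move=> x; apply/esym/raddP; rewrite hadd0x. Qed.

Let raddN : left_inverse rzero ropp radd.
Proof. by move=> x; rewrite raddC; apply/esym/raddP/haddxN. Qed.

(* The intermediate sum s is residual unless y = - x; in that case s lies
   below the residual tier and is absorbed by z. *)
Let raddA : associative radd.
Proof.
move=> x y z; set w := radd x _; apply/raddP.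
have xtw : (val x ⊞ val (radd y z)) (val w) by apply/raddP.
have yzt : (val y ⊞ val z) (val (radd y z)) by apply/raddP.
have [s xys szw] := hadd_assoc yzt xtw.
have xy : (val x ⊞ val y) (val (radd x y)) by apply/raddP.
have [yx|yx] := pselect (val y = - val x); last first.
  by rewrite (stR yx xy xys).
have -> : radd x y = rzero.
  by apply/esym/raddP; rewrite yx; apply/haddxN.
move: xys; rewrite yx => /(hadd_opp (valP x))[s0|[l sl l1]].
  by move: szw; rewrite s0.
move: szw; rewrite hadd0x sl; have [z0|[k zk]] := hunitP (val z).
  rewrite z0 haddx0 => wl.
  by move: (valP w) l1; rewrite wl residual_val => /eqP ->; rewrite ltxx.
have := valP z; rewrite zk residual_val => /eqP k1.
by rewrite haddC hadd_ltl // k1.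
Qed.

HB.instance Definition _ := GRing.isZmodule.Build T raddA raddC radd0 raddN.

Let rmulA : associative rmul.
Proof. by move=> x y z; apply: val_inj; rewrite /= mulgA. Qed.
Let rmul1 : left_id rone rmul.
Proof. by move=> x; apply: val_inj; rewrite /= mul1g. Qed.
Let rmulr1 : right_id rone rmul.
Proof. by move=> x; apply: val_inj; rewrite /= mulg1. Qed.
Let rmulDl : left_distributive rmul radd.
Proof. by move=> x y z; apply/raddP/haddMr/raddP. Qed.
Let rmulDr : right_distributive rmul radd.
Proof. by move=> x y z; apply/raddP/haddMl/raddP. Qed.
Let rone_neq0 : rone != rzero.
Proof. by apply/eqP => /(congr1 val) /esym/hzero_neq1. Qed.

HB.instance Definition _ := GRing.Zmodule_isNzRing.Build T
  rmulA rmul1 rmulr1 rmulDl rmulDr rone_neq0.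

Let unit : {pred T} := [pred x | x != 0%R].

Let val_neq0 (x : T) : x != 0%R -> val x != 0.
Proof. by apply: contra_neq => x0; apply: val_inj. Qed.

Let rmulV : {in unit, left_inverse 1%R rinv *%R}.
Proof. by move=> x /val_neq0/hinvP[_ xV]; apply: val_inj. Qed.
Let rmulrV : {in unit, right_inverse 1%R rinv *%R}.
Proof. by move=> x /val_neq0/hinvP[xV _]; apply: val_inj. Qed.
Let runitP x y : (y * x = 1)%R /\ (x * y = 1)%R -> unit x.
Proof.
move=> [yx _]; apply/eqP => x0.
by have := @GRing.oner_neq0 T; rewrite -yx x0 mulr0 eqxx.
Qed.
Let rinv_out : {in [predC unit], rinv =1 id}.
Proof.
move=> x; rewrite inE negbK => /eqP ->.
by apply: val_inj; rewrite /= hinv0.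
Qed.

HB.instance Definition _ := GRing.NzRing_hasMulInverse.Build T
  rmulV rmulrV runitP rinv_out.

Let fieldT : GRing.field_axiom T. Proof. by []. Qed.

Local Notation F := (hyperfield_of fieldT).

Let phi (u : hunit F) : hunit R := Sub (val (val u : T)) (val_neq0 (valP u)).

Let phiM : {morph phi : u v / u * v}.
Proof. by move=> u v; apply: val_inj. Qed.

HB.instance Definition _ := isMultiplicative.Build (hunit F) (hunit R) phi phiM.

Lemma residue_layering : range psi = setT ->
  exists (D : unitRingType) (fD : GRing.field_axiom D)
    (E : stable_extension (hyperfield_of fD) G),
  hyperfield_isomorphic R (layering E).
Proof.
move=> psi_surj; exists T, fieldT.
apply: (@layering_recognition _ _ _ _ phi psi) => //.
- split=> //.
    by move=> u v /(congr1 val) uv; apply: val_inj; exact: (@val_inj _ _ T) uv.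
  rewrite eqEsubset; split=> [_ [u _ <-]|h /= /eqP h1].
    by apply/eqP; rewrite -residual_val; exact: (valP (val u : T)).
  rewrite -residual_val in h1.
  pose a : F := (Sub (val h) h1 : T); have a0 : a != 0.
    by apply/eqP => hE; have /eqP[] := valP h; exact: (congr1 val hE).
  by exists (Sub a a0 : hunit F) => //; apply: val_inj.
- by move=> u v; exact: (raddP rone (val u : T) (val v : T)).
- move=> u; split=> uE; [exact: (@val_inj _ _ T (val u) (ropp rone)) uE|].
  exact: (congr1 (val : T -> R) uE).
- by move=> h /null_psi/ltW.
Qed.

End ResidueField.

(** * The value group and the three types *)

Section ValueGroup.
Variable R : skewHyperfieldType.
Local Notation D := ((1 : R) ⊞ - (1 : R)).
Hypothesis stR : stringent R.

Implicit Types h k : hunit R.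

Lemma null_conj k z : D z -> D (val k^-1 * z * val k).
Proof.
move=> /(haddMl (val k^-1)) /(haddMr (val k)).
by rewrite mulg1 hmulxN1 hmulNx hunitVK.
Qed.

(** The cone is the set of h with hD ⊆ D, so values are ordered as the sets hD by inclusion. The
    order is total by [null_total], as h ∈ D implies hD ⊆ D by [null_mul]. *)
Lemma value_group :
  exists (d : Order.disp_t) (G : orderedGroupType d)
    (psi : {multiplicative hunit R -> G}),
  range psi = setT /\
  forall h, (psi h <= 1)%O <-> forall z, D z -> D (val h * z).
Proof.
apply: ordered_quotient => [h k hD kD z Dz|h k hD z Dz|h].
- by rewrite -mulgA; apply/hD/kD.
- have kz : D (val k * z * val k^-1).
    by have := null_conj k^-1 Dz; rewrite invgK.
  have := null_conj k (hD _ kz).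
  by rewrite -!mulgA hunitVK mulg1 !mulgA.
have [Dh|] := null_total stR (valP h); last by right.
by left=> z; exact: null_mul.
Qed.

Variables (d : Order.disp_t) (G : orderedGroupType d).
Variable psi : {multiplicative hunit R -> G}.
Hypothesis psi_surj : range psi = setT.
Hypothesis psi_le1 :
  forall h, (psi h <= 1)%O <-> forall z, D z -> D (val h * z).

Lemma psi_ge1 h : (1 <= psi h)%O <-> forall z, D z -> D (val h^-1 * z).
Proof.
rewrite -psi_le1; split=> [/(le_mulg2l (psi h^-1))|/(le_mulg2l (psi h))];
  by rewrite -gmulfM ?mulVg ?mulgV multiplicative1 mulg1.
Qed.

Lemma null_le1 h : D (val h) -> (psi h <= 1)%O.
Proof. by move=> Dh; apply/psi_le1 => z; exact: null_mul. Qed.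

(** If h is not in D, then h^-1 D ⊆ D by [null_total], which means that h has value at least 1. *)
Lemma lt1_null h : (psi h < 1)%O -> D (val h).
Proof.
have [//|hV] := null_total stR (valP h).
by rewrite ltNge => /negP[]; apply/psi_ge1.
Qed.

(** Value 1 means hD = D, so 1 ∈ D puts both h and h^-1 into D. The latter gives h ∈ h ⊞ 1, while
    the former gives 1 ⊞ h = {1} when h ≠ - 1. *)
Lemma psi1_cases h : D 1 -> psi h = 1 -> val h = 1 \/ val h = - (1 : R).
Proof.
move=> D1 h1; have [|hN1] := pselect (val h = - (1 : R)); [by right|left].
have Dh : D (val h).
  by rewrite -[val h]mulg1; apply: ((psi_le1 h).1 _) D1; rewrite h1 lexx.
have DhV : D (val h^-1).
  by rewrite -[val h^-1]mulg1; apply: ((psi_ge1 h).1 _) D1; rewrite h1 lexx.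
apply: (hadd_null1 stR Dh hN1); move/nullP: DhV => /(haddMl (val h)).
by rewrite mulg1 hunitKV haddC.
Qed.

(** By [psi1_cases] the kernel of [psi] is trivial, as is the unit group of [krasner]; hence [phi]
    is the constant morphism. *)
Lemma null1_krasner : D 1 -> - (1 : R) = 1 -> krasner_layering R.
Proof.
move=> D1 N1; exists krasner, d, G.
have psi1 h : psi h = 1 -> h = 1.
  by move=> /(psi1_cases D1); rewrite N1 => -[] hE; exact: val_inj.
pose phi : {multiplicative hunit krasner -> hunit R} :=
  @one_fun (hunit krasner) (hunit R).
have [|||||E] := @layering_recognition R krasner d G phi psi stR.
- split=> //.
    by move=> u v _; apply: val_inj; case: u v => -[] // u [[] // v].
  rewrite eqEsubset; split=> [_ [u _ <-]|h /psi1 ->].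
    exact: multiplicative1.
  by exists 1.
- move=> u v; have [-> ->] : val u = K1 /\ val v = K1.
    by case: u v => -[] // u [[] // v].
  by split=> _; [right|exact/nullP].
- by move=> u; split=> _; [case: u => -[]|rewrite N1].
- exact: lt1_null.
- exact: null_le1.
move=> iso; exists E; split=> //; exists id; split=> //; first by exists id.
by move=> x y; rewrite image_id.
Qed.

Let sgn (u : hunit sign) : hunit R := if val u is Sm1 then hunitN1 R else 1.

Let hunit_signP (u : hunit sign) : val u = S1 \/ val u = Sm1.
Proof. by case: u => -[] // u; [left|right]. Qed.

Let hunitN1K : hunitN1 R * hunitN1 R = 1.
Proof. by apply: val_inj; rewrite /= hmulxN1 hoppK. Qed.

Let sgnM : {morph sgn : u v / u * v}.
Proof.
move=> u v; rewrite /sgn.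
have -> : val (u * v) = sign_mul (val u) (val v) by [].
have [->|->] := hunit_signP u; have [->|->] := hunit_signP v;
  by rewrite ?mul1g ?mulg1 ?hunitN1K.
Qed.

HB.instance Definition _ :=
  isMultiplicative.Build (hunit sign) (hunit R) sgn sgnM.

(** The kernel of [psi] is {1, - 1}, the image of [sgn]. Its elements add like signs: 1 ⊞ 1 = {1} by
    [hadd_null1], while D contains both 1 and - 1. *)
Lemma null1_sign : D 1 -> - (1 : R) <> 1 -> sign_layering R.
Proof.
move=> D1 N1; exists sign, d, G.
have val_sgn u : val (sgn u) = (if val u is Sm1 then - (1 : R) else 1).
  by rewrite /sgn; have [->|->] := hunit_signP u.
have add11 z : ((1 : R) ⊞ 1) z -> z = 1.
  by apply: hadd_null1 => // /esym.
have DN1 := nullN D1.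
have [|||||E] := @layering_recognition R sign d G sgn psi stR.
- split=> //.
    move=> u v /(congr1 val); rewrite !val_sgn => uv; apply: val_inj.
    have N1' : 1 <> - (1 : R) by move/esym.
    by move: uv; have [->|->] := hunit_signP u; have [->|->] := hunit_signP v.
  rewrite eqEsubset; split=> [_ [u _ <-]|h /(psi1_cases D1)[]hE].
  - rewrite /= /sgn; have [->|->] := hunit_signP u.
      exact: multiplicative1.
    exact: psiN1.
  - by exists 1 => //; apply: val_inj; rewrite hE.
  - by exists (hunitN1 sign) => //; apply: val_inj; rewrite hE.
- move=> u v; rewrite !val_sgn.
  have [->|->] := hunit_signP u; have [->|->] := hunit_signP v.
  + by split=> // _; exact/nullP.
  + by split=> // /add11.
  + by split=> // _; left; right.
  + by split=> // _; right.
- move=> u; rewrite val_sgn; have [->|->] := hunit_signP u => //.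
  by split=> // /esym.
- exact: lt1_null.
- exact: null_le1.
move=> iso; exists E; split=> //; exists id; split=> //; first by exists id.
by move=> x y; rewrite image_id.
Qed.

(** An h in D of value 1 would satisfy h^-1 D ⊆ D and so give 1 ∈ D. Hence the nonzero elements of D
    are those of value below 1, [residue_layering] applies, and D ⊆ DD projects to the condition on
    G. *)
Lemma null1_skew_field : ~ D 1 -> D `<=` [set x * y | x in D & y in D] ->
  skew_field_layering R.
Proof.
move=> D1 Dsub.
have null_psi h : D (val h) <-> (psi h < 1)%O.
  split=> [Dh|]; last exact: lt1_null.
  rewrite lt_neqAle null_le1 // andbT; apply/eqP => h1; apply: D1.
  by have := (psi_ge1 h).1; rewrite h1 lexx => /(_ isT _ Dh); rewrite hunitVK.
have [T [fT [E RE]]] := residue_layering stR null_psi psi_surj.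
exists (hyperfield_of fT), d, G, E; split=> //.
  exists T, fT, id; split=> //; first by exists id.
  by move=> x y; rewrite image_id.
rewrite eqEsubset; split=> [_ [a a1 [b b1 <-]]|c c1].
  apply: le_lt_trans b1; rewrite -[leRHS]mul1g; exact: le_mulg2r (ltW a1).
have : range psi c by rewrite psi_surj.
move=> [h _ hc]; move: c1; rewrite -hc => /= /null_psi/Dsub[x Dx [y Dy xy]].
move: Dx Dy xy; have [->|[k ->]] := hunitP x.
  by move=> _ _ /esym; rewrite hmul0x => h0; have := valP h; rewrite h0 eqxx.
have [->|[l ->]] := hunitP y.
  by move=> _ _ /esym; rewrite hmulx0 => h0; have := valP h; rewrite h0 eqxx.
move=> /null_psi k1 /null_psi l1 kl; have <- : k * l = h by apply: val_inj.
by exists (psi k) => //; exists (psi l) => //; rewrite gmulfM.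
Qed.

End ValueGroup.

(** * Double distributivity and mutual exclusion of the three types *)

Lemma krasner_layeringP (R : skewHyperfieldType) : krasner_layering R ->
  [/\ doubly_distributive R, ((1 : R) ⊞ - (1 : R)) 1 & - (1 : R) = 1].
Proof.
move=> [F [d [G [E [[f isof] [g isog]]]]]].
have F1 := (iso_null isof 1).1; have [_ _ f1 _ _] := isof.
rewrite f1 in F1; have {}F1 := F1 krasner_null1.
have [_ _ g1 _ _] := isog.
split.
- apply/(iso_doubly_distributive isog)/layering_doubly_distributive_null1 => //.
  exact: iso_stringent isof krasner_stringent.
- by apply/(iso_null isog); rewrite g1; apply/layering_null1.
by apply/(iso_hopp1 isog)/layering_hopp1_eq1/(iso_hopp1 isof).
Qed.

Lemma sign_layeringP (R : skewHyperfieldType) : sign_layering R ->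
  [/\ doubly_distributive R, ((1 : R) ⊞ - (1 : R)) 1 & - (1 : R) <> 1].
Proof.
move=> [F [d [G [E [[f isof] [g isog]]]]]].
have F1 := (iso_null isof 1).1; have [_ _ f1 _ _] := isof.
rewrite f1 in F1; have {}F1 := F1 sign_null1.
have [_ _ g1 _ _] := isog.
split.
- apply/(iso_doubly_distributive isog)/layering_doubly_distributive_null1 => //.
  exact: iso_stringent isof sign_stringent.
- by apply/(iso_null isog); rewrite g1; apply/layering_null1.
by move=> /(iso_hopp1 isog)/layering_hopp1_eq1/(iso_hopp1 isof).
Qed.

Lemma skew_field_layeringP (R : skewHyperfieldType) : skew_field_layering R ->
  doubly_distributive R /\ ~ ((1 : R) ⊞ - (1 : R)) 1.
Proof.
move=> [F [d [G [E [[D [fD [f isof]]] G1 [g isog]]]]]].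
have F0 : ((1 : F) ⊞ - (1 : F)) `<=` [set 0].
  move=> z /(iso_null isof)/skew_field_null fz.
  by have [/bij_inj f_inj f0 _ _ _] := isof; apply: f_inj; rewrite fz f0.
have [_ _ g1 _ _] := isog.
split.
  apply/(iso_doubly_distributive isog)/layering_doubly_distributive_null0 => //.
  by apply: (iso_stringent isof); exact: skew_field_stringent.
move=> /(iso_null isog); rewrite g1 => /layering_null1/F0/esym.
exact: hzero_neq1.
Qed.

(** Two invariants of R determine the type: whether 1 ∈ 1 ⊟ 1 separates the first two types from the
    third, and whether - 1 = 1 separates the first from the second. *)
Theorem proposition5p1 (R : skewHyperfieldType) :
  (doubly_distributive R <->
   [\/ krasner_layering R, sign_layering R | skew_field_layering R]) /\
  [/\ ~ (krasner_layering R /\ sign_layering R),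
      ~ (krasner_layering R /\ skew_field_layering R) &
      ~ (sign_layering R /\ skew_field_layering R)].
Proof.
split; [split|split].
- move=> /doubly_distributiveP[stR Dsub].
  have [d [G [psi [psi_surj psi_le1]]]] := value_group stR.
  have [D1|D1] := pselect (((1 : R) ⊞ - (1 : R)) 1).
    have [N1|N1] := pselect (- (1 : R) = 1).
      by constructor 1; exact: null1_krasner psi_le1 D1 N1.
    by constructor 2; exact: null1_sign psi_le1 D1 N1.
  by constructor 3; exact: null1_skew_field psi_surj psi_le1 D1 Dsub.
- by case=> [/krasner_layeringP[]|/sign_layeringP[]|/skew_field_layeringP[]].
- by move=> [/krasner_layeringP[_ _ N1] /sign_layeringP[_ _]].
- by move=> [/krasner_layeringP[_ D1 _] /skew_field_layeringP[_]].
- by move=> [/sign_layeringP[_ D1 _] /skew_field_layeringP[_]].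
Qed.
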